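(* Let $d$ be a positive integer and let $\mathcal{F}:\mathcal{P}(\mathbb{S}^{d-1})\to\mathbb{R}^{d\times d}$ be such that there is a constant $L_{\mathcal{F}}\ge 0$ with $\|\mathcal{F}[\varrho]-\mathcal{F}[\widetilde\varrho]\|_{\mathrm{op}}\le L_{\mathcal{F}}W_1(\varrho,\widetilde\varrho)$ for all $\varrho,\widetilde\varrho\in\mathcal{P}(\mathbb{S}^{d-1})$, and such that $\mathrm{tr}(\mathcal{F}[\varrho])=0$ for all $\varrho\in\mathcal{P}(\mathbb{S}^{d-1})$. Let $Q\subseteq\mathcal{P}(\mathbb{R}^d)$ be a parametric family of probability distributions satisfying $q(\{0\})=0$ for every $q\in Q$. Suppose that $Q$ is closed under every linear transformation $\Lambda_G:\mathbb{R}^d\to\mathbb{R}^d$, $\Lambda_G(x):=Gx$, with $G\in\mathrm{GL}(d,\mathbb{R})$; that is, $(\Lambda_G)_\sharp q\in Q$ for every $q\in Q$ and $G\in\mathrm{GL}(d,\mathbb{R})$. Then the associated projected family $$P_Q:=\{\Pi_\sharp q:q\in Q\}\subseteq\mathcal{P}(\mathbb{S}^{d-1}),\qquad \Pi(x):=\frac{x}{\|x\|}\ \ (x\in\mathbb{R}^d\setminus\{0\}),$$ is invariant under the mean-field dynamics $$\partial_t\rho+\operatorname{div}_{\mathbb{S}^{d-1}}(b(\cdot,\rho)\rho)=0,\qquad b(x,\varrho):=(I_d-xx^{\top})\mathcal{F}[\varrho]x;$$ that is, whenever $\rho(0)=\rho_0\in P_Q$, the corresponding solution satisfies $\rho(t)\in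 P_Q$ for every $t\ge0$.
   Context: $\mathbb{S}^{d-1}$ is the unit sphere in $\mathbb{R}^d$ with the Euclidean norm $\|\cdot\|$; $\|\cdot\|_{\mathrm{op}}$ is the matrix operator norm; $\mathcal{P}(\mathcal{X})$ is the set of (Borel) probability measures on $\mathcal{X}$; $\mathcal{P}(\mathbb{S}^{d-1})$ is equipped with the Wasserstein-1 distance $W_1$ induced by the Euclidean distance. $h_\sharp\mu$ is the pushforward of $\mu$ under $h$ (the condition $q(\{0\})=0$ makes $\Pi$ defined $q$-a.s.). $\mathrm{GL}(d,\mathbb{R})$ is the set of invertible matrices in $\mathbb{R}^{d\times d}$. A parametric family is a set of probability distributions determined by finitely many parameters. The solution of the mean-field equation means the unique weak solution: a curve $\rho\in C([0,\infty);\mathcal{P}(\mathbb{S}^{d-1}))$ (continuous for $W_1$) with $\rho(0)=\rho_0$ such that, for every $\varphi\in C^1(\mathbb{S}^{d-1})$ and every $t\ge0$, $$\int\varphi(x)\,d\rho(t,x)-\int\varphi(x)\,d\rho_0(x)=\int_0^t\int\nabla_{\mathbb{S}^{d-1}}\varphi(x)^{\top}b(x,\rho(s))\,d\rho(s,x)\,ds,$$ where integrals in $x$ are over $\mathbb{S}^{d-1}$ and $\nabla_{\mathbb{S}^{d-1}}$ is the spherical gradient viewed as a tangent vector in $\mathbb{R}^d$. *)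

(* Defs.v *)
From HB Require Import structures.
From mathcomp Require Import all_boot all_order all_algebra.
From mathcomp Require Import all_classical all_reals all_analysis.
From mathcomp Require Import giry.

Set Implicit Arguments.
Unset Strict Implicit.
Unset Printing Implicit Defensive.
Import Order.TTheory GRing.Theory Num.Theory.
Import numFieldNormedType.Exports.

Local Open Scope classical_set_scope.
Local Open Scope ring_scope.

(* A positive dimension is written d.+1. The norm `|x| of the library on
   matrices is the sup norm: it is only used through its topology, and the
   Euclidean and operator norms are defined here. *)

Section EuclideanSpace.
Context {R : realType}.

Definition enorm {n} (x : 'cV[R]_n) : R := Num.sqrt (\sum_i x i 0 ^+ 2).

Definition opnorm {n} (A : 'M[R]_n) : R :=
  sup [set enorm (A *m x) | x in [set x : 'cV[R]_n | enorm x <= 1]].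

Lemma enorm_ge0 n (x : 'cV[R]_n) : 0 <= enorm x.
Proof. exact: sqrtr_ge0. Qed.

Lemma enormZ n (a : R) (x : 'cV[R]_n) : enorm (a *: x) = `|a| * enorm x.
Proof.
rewrite /enorm -sqrtr_sqr -sqrtrM ?sqr_ge0// mulr_sumr.
by congr Num.sqrt; apply: eq_bigr => i _; rewrite mxE exprMn.
Qed.

Lemma enorm_eq0 n (x : 'cV[R]_n) : (enorm x == 0) = (x == 0).
Proof.
apply/idP/eqP => [|->]; last first.
  by rewrite /enorm big1 ?sqrtr0// => i _; rewrite mxE expr0n.
rewrite sqrtr_eq0 => x0; apply/colP => i; rewrite mxE; apply/eqP.
rewrite -sqrf_eq0 eq_le sqr_ge0 andbT (le_trans _ x0)//.
by rewrite (bigD1 i)//= lerDl sumr_ge0// => j _; exact: sqr_ge0.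
Qed.

Lemma mx_cvg_coord (T : Type) (F : set_system T) m n (f : T -> 'M[R]_(m, n))
    (A : 'M[R]_(m, n)) : Filter F ->
  (forall i j, f x i j @[x --> F] --> A i j) -> f x @[x --> F] --> A.
Proof.
move=> FF fA; apply/cvg_ballP => e e0; near=> x; split=> // i j.
move: i j; near: x; apply: filter_forall => i; apply: filter_forall => j.
by have /cvg_ballP/(_ e e0) := fA i j.
Unshelve. all: by end_near. Qed.

Lemma cvg_sum_ord (T : Type) (F : set_system T) n (f : 'I_n -> T -> R)
    (l : 'I_n -> R) : Filter F ->
  (forall i, f i x @[x --> F] --> l i) ->
  \sum_i f i x @[x --> F] --> \sum_i l i.
Proof.
move=> FF fl; elim: (index_enum _) => [|i s ih].
  under eq_cvg do rewrite big_nil.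
  by rewrite big_nil; exact: cvg_cst.
under eq_cvg do rewrite big_cons.
by rewrite big_cons; apply: cvgD => //; exact: fl.
Qed.

Lemma enorm_continuous n : continuous (@enorm n).
Proof.
move=> x; apply: (@continuous_comp _ _ _ (fun x : 'cV[R]_n => \sum_i x i 0 ^+ 2)).
  apply: (@cvg_sum_ord _ (nbhs x) _ _ _ (nbhs_filter x)) => i; rewrite expr2.
  under eq_cvg do rewrite expr2.
  by apply: cvgM; exact: coord_continuous.
exact: sqrt_continuous.
Qed.

Lemma mulmx_continuous m n (A : 'M[R]_(m, n)) :
  continuous (fun x : 'cV[R]_n => A *m x).
Proof.
move=> x; apply: (@mx_cvg_coord _ (nbhs x) _ _ _ _ (nbhs_filter x)) => i j; rewrite mxE.
under eq_cvg do rewrite mxE.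
by apply: (@cvg_sum_ord _ (nbhs x) _ _ _ (nbhs_filter x)) => k; apply: cvgMl_tmp; exact: coord_continuous.
Qed.

End EuclideanSpace.

Definition borelType (T : ptopologicalType) := g_sigma_algebraType (@open T).
HB.instance Definition _ (T : ptopologicalType) :=
  Measurable.copy (borelType T) (g_sigma_algebraType (@open T)).

Lemma open_borel (T : ptopologicalType) (A : set T) :
  open A -> measurable (A : set (borelType T)).
Proof. by move=> oA; exact: sub_sigma_algebra. Qed.

Lemma borel_measurable_fun (T U : ptopologicalType)
    (f : borelType T -> borelType U) :
  (forall A : set U, open A -> measurable (f @^-1` A)) ->
  measurable_fun setT f.
Proof.
move=> mf; apply: (@measurability _ _ _ _ setT f open) => // _ [A oA <-].
by rewrite setTI; exact: mf.
Qed.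

Section Sphere.
Context (R : realType) (d : nat).

Definition usphere : set 'cV[R]_d.+1 := [set x | enorm x = 1].

Definition sphere : Type := usphere.

HB.instance Definition _ := Topological.copy sphere (set_type usphere).

Lemma sphere_point_subproof : delta_mx 0 0 \in usphere.
Proof.
rewrite inE /usphere /= /enorm (bigD1 0)//= big1 ?addr0.
  by rewrite mxE eqxx expr1n sqrtr1.
by move=> i /negbTE i0; rewrite mxE i0 expr0n.
Qed.

HB.instance Definition _ := isPointed.Build sphere
  (exist _ (delta_mx 0 0) sphere_point_subproof : set_type usphere).

End Sphere.

Notation Rn R d := (borelType 'cV[R]_d.+1).
Notation prob_space R d := (probability (Rn R d) R).
Notation prob_sphere R d := (probability (borelType (sphere R d)) R).

Section Maps.
Context (R : realType) (d : nat).

Definition Lambda (G : 'M[R]_d.+1) : Rn R d -> Rn R d := fun x => G *m x.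

Lemma measurable_Lambda G : measurable_fun setT (Lambda G).
Proof.
apply: borel_measurable_fun => A oA; apply: open_borel.
by move/continuousP : (@mulmx_continuous R _ _ G); exact.
Qed.

HB.instance Definition _ G :=
  isMeasurableFun.Build _ _ _ _ (Lambda G) (measurable_Lambda G).

(* Pi x = x / |x| for x != 0 (val_Pi); Pi 0 is an arbitrary point. *)
Definition Pi (x : Rn R d) : borelType (sphere R d) :=
  insubd (point : sphere R d) ((enorm x)^-1 *: (x : 'cV[R]_d.+1)).

Lemma val_Pi (x : 'cV[R]_d.+1) : x != 0 -> val (Pi x) = (enorm x)^-1 *: x.
Proof.
move=> x0; rewrite insubdK// inE /usphere /= enormZ normfV ger0_norm ?enorm_ge0//.
by rewrite mulVf// enorm_eq0.
Qed.

Lemma measurable_Pi : measurable_fun setT Pi.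
Proof.
apply: borel_measurable_fun => _ [W oW <-].
pose normalize (x : 'cV[R]_d.+1) := (enorm x)^-1 *: x.
have oN : open (~` [set (0 : 'cV[R]_d.+1)]).
  exact/closed_openC/accessible_closed_set1/hausdorff_accessible/norm_hausdorff.
have oU : open (~` [set 0] `&` normalize @^-1` W).
  rewrite openE => x [/= x0 Wx]; apply: filterI; first exact: open_nbhs_nbhs.
  have cx : normalize y @[y --> x] --> normalize x.
    apply: (@cvgZ _ _ _ (nbhs x) (nbhs_filter x)) => //.
    apply: cvgV; last exact: enorm_continuous.
    by rewrite enorm_eq0; exact/eqP.
  by apply: cx; exact: open_nbhs_nbhs.
rewrite [X in measurable X](_ : _ = (~` [set 0] `&` normalize @^-1` W) `|`
    ([set 0] `&` Pi @^-1` (set_val @^-1` W))); last first.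
  apply/seteqP; split=> x /=; rewrite set_valE; last first.
    by case=> [[/eqP x0 Wx]|[]]//; rewrite /= -/(Pi x) val_Pi.
  have [->|x0] := eqVneq x 0; first by right.
  by rewrite val_Pi// => Wx; left; split => //; exact/eqP.
apply: measurableU; first exact: open_borel.
have [P0|P0] := pselect (W (val (Pi 0))).
  rewrite (_ : _ `&` _ = [set 0]).
    by rewrite -[X in measurable X]setCK; apply: measurableC; exact: open_borel.
  by apply/seteqP; split=> [x []//|x ->]; split.
by rewrite (_ : _ `&` _ = set0)//; apply/seteqP; split=> // x [-> /=].
Qed.

HB.instance Definition _ :=
  isMeasurableFun.Build _ _ _ _ Pi measurable_Pi.

End Maps.

(* Measures of the library are functions on all sets, with unspecified values
   on non-measurable ones. Equality of probability measures is therefore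
   rendered by [measure_eq], agreement on all measurable sets, rather than by
   Leibniz equality. *)
Section Families.
Context {R : realType} {d : nat}.
Implicit Types (Q : set (prob_space R d)) (F : prob_sphere R d -> 'M[R]_d.+1).

(* As for all sets of measures below, membership only depends on the values
   taken on measurable sets. *)
Definition parametric_family Q : Prop :=
  exists (k : nat) (Theta : set 'rV[R]_k) (q : 'rV[R]_k -> prob_space R d),
    forall mu, Q mu <-> exists2 theta, Theta theta & measure_eq mu (q theta).

Definition projected_family Q : set (prob_sphere R d) :=
  [set mu | exists2 q, Q q &
    measure_eq mu (distribution q (@Pi R d) : prob_sphere R d)].

Definition coupling (mu nu : prob_sphere R d) :
    set (probability (borelType (sphere R d) * borelType (sphere R d))%type R) :=
  [set gamma | forall A : set (borelType (sphere R d)), measurable A ->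
    gamma (A `*` setT) = mu A /\ gamma (setT `*` A) = nu A].

Definition W1 (mu nu : prob_sphere R d) : \bar R :=
  ereal_inf [set (\int[gamma]_z (enorm (val z.1 - val z.2))%:E)%E
            | gamma in coupling mu nu].

(* A function phi on the sphere is C^1, and its spherical gradient at x is the
   Euclidean gradient at x, when these are computed on the extension
   y |-> phi (y / |y|) of phi to the nonzero vectors. This extension being
   constant along rays, its gradient at x is orthogonal to x. *)
Definition radial_ext (phi : sphere R d -> R) : 'cV[R]_d.+1 -> R :=
  fun y => phi (Pi y).

Definition C1_sphere (phi : sphere R d -> R) : Prop :=
  forall y : 'cV[R]_d.+1, y != 0 ->
    differentiable (radial_ext phi) y /\
    forall i, {for y, continuous (fun z => 'D_(delta_mx i 0) (radial_ext phi) z)}.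

Definition sphere_grad (phi : sphere R d -> R) (x : sphere R d) : 'cV[R]_d.+1 :=
  \col_i 'D_(delta_mx i 0) (radial_ext phi) (val x).

Definition velocity F (x : 'cV[R]_d.+1) (mu : prob_sphere R d) : 'cV[R]_d.+1 :=
  (1%:M - x *m x^T) *m F mu *m x.

(* Only the values of rho on [0, +oo[ are constrained. *)
Definition weak_solution F (rho0 : prob_sphere R d) (rho : R -> prob_sphere R d)
    : Prop :=
  [/\ forall t : R, 0 <= t ->
        W1 (rho s) (rho t) @[s --> within [set s | 0 <= s] (nbhs t)] --> 0%E,
      measure_eq (rho 0) rho0
    & forall phi : sphere R d -> R, C1_sphere phi -> forall t : R, 0 <= t ->
        \int[rho t]_x phi x - \int[rho0]_x phi x =
        \int[lebesgue_measure]_(s in `[0, t])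
          \int[rho s]_x ((sphere_grad phi x)^T *m velocity F (val x) (rho s)) 0 0].

End Families.

(* Main.v *)
(** Along a weak solution the matrix A(s) = F(rho(s)) is continuous in s, so rho
solves a linear continuity equation whose flow on the sphere is the projection
x |-> Gx/|Gx| of the linear flow G' = A G. Rather than flowing forward, solve
H' = - H A with H invertible. For a C^1 function phi on the sphere, with
0-homogeneous extension w, the chain rule, Euler's relation Dw(y)y = 0 and the
weak formulation show that the integral of w(H(s)x) against rho(s) does not
depend on s. Hence rho(t) and the image of rho(0) under the projective action of
H(t)^-1 H(0) integrate C^1 functions equally, so they coincide; and that action
commutes with the projection Pi. *)
Require Import Defs.
From mathcomp Require Import all_boot all_order all_algebra.
From mathcomp Require Import all_classical all_reals all_analysis measurable_realfun.
From mathcomp Require Import ring lra.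

Set Implicit Arguments.
Unset Strict Implicit.
Unset Printing Implicit Defensive.
Import Order.TTheory GRing.Theory Num.Theory.
Import numFieldNormedType.Exports.
Local Open Scope classical_set_scope.
Local Open Scope ring_scope.

(** * Linear differential equations *)

(** Since [rho] is given, [F (rho s)] is a known matrix curve and the equation becomes linear. The
    equation for H is chosen so that H(s)x(s) is constant along x' = A x; thus w(H(s)x) solves the
    adjoint transport equation, and testing against it identifies rho(t) directly. The obstacle is
    that the weak formulation admits only test functions independent of time, whereas w(H(s)x) moves
    with s and is merely C^1. The difference quotient at s is therefore split. With the integrand
    frozen at s, the weak formulation and the fundamental theorem of calculus apply; with the
    integrand moving, the mean value theorem replaces the quotient by a derivative at a nearby time.
    Both parts require limits of integrals in which integrand and measure vary together: compactness
    of the sphere makes the convergence of integrands uniform, and W1 controls the measures. *)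

Section ParameterizedIntegral.
Context {R : realType}.
Local Notation mu := (@lebesgue_measure R).

Lemma continuous_integrable_itv (f : R -> R) (a b : R) : continuous f ->
  mu.-integrable `[a, b] (EFin \o f).
Proof.
move=> cf; apply: continuous_compact_integrable; first exact: segment_compact.
exact: continuous_subspaceT.
Qed.

Lemma is_derive_Rintegral (f : R -> R) (a t : R) : continuous f -> a < t ->
  is_derive t 1 (fun t => \int[mu]_(s in `[a, t]) f s) (f t).
Proof.
move=> cf at_; have [//|//|df <-] := @continuous_FTC1_closed _ f a t (t + 1) _ _ at_ (cf t).
- by rewrite ltrDl.
- exact: continuous_integrable_itv.
by rewrite derive1E; exact: derivableP.
Qed.

(** For t < a the interval is empty and the integral is 0, so a constant branch has to be glued at
    [a] to the differentiable one. *)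
Lemma continuous_Rintegral (f : R -> R) (a : R) : continuous f ->
  continuous (fun t => \int[mu]_(s in `[a, t]) f s).
Proof.
move=> cf t; have [ta|at_|->] := ltgtP t a.
- apply: (@cvg_trans _ ((fun=> 0) x @[x --> t])).
    apply: near_eq_cvg; near=> x.
    by rewrite set_itv_ge ?Rintegral_set0// bnd_simp -ltNge; near: x; exact: lt_nbhsl.
  rewrite (_ : Rintegral _ _ _ = 0); first exact: (@cst_continuous R R 0 t).
  by rewrite set_itv_ge ?Rintegral_set0// bnd_simp -ltNge.
- have [df _] := is_derive_Rintegral cf at_.
  by apply: differentiable_continuous; exact/derivable1_diffP.
- rewrite /continuous_at set_itv1 Rintegral_set1.
  apply: (@parameterized_integral_cvg_left _ a (a + 1)); first by rewrite ltrDl.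
  exact: continuous_integrable_itv.
Unshelve. all: by end_near. Qed.

End ParameterizedIntegral.

Section LinearODE.
Context {R : realType} (n : nat).
Local Notation mu := (@lebesgue_measure R).
Variables (B : R -> 'M[R]_n) (a M : R).
Hypothesis cB : forall i j, continuous (fun t => B t i j).
Hypothesis BM : forall t i j, `|B t i j| <= M.

(** The initial value is left out of the operator, so that its iterates from the identity are the
    terms of the Peano-Baker series and [picard_sum] gives the usual Picard iterates. *)
Definition picard_step (Y : R -> 'M[R]_n) : R -> 'M[R]_n :=
  fun t => \matrix_(i, j) \int[mu]_(s in `[a, t]) (B s *m Y s) i j.

Definition picard_term k : R -> 'M[R]_n := iter k picard_step (fun=> 1%:M).

Lemma continuous_mulmx_coord (Y : R -> 'M[R]_n) i j :
  (forall i j, continuous (fun t => Y t i j)) ->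
  continuous (fun t => (B t *m Y t) i j).
Proof.
move=> cY; rewrite (_ : (fun t => _) = fun t => \sum_k B t i k * Y t k j); last first.
  by apply/funext => t; rewrite mxE.
move=> t; apply: (@cvg_sum_ord _ _ (nbhs t)) => k.
by apply: cvgM; [exact: cB|exact: cY].
Qed.

Lemma continuous_picard_term k i j : continuous (fun t => picard_term k t i j).
Proof.
elim: k i j => [|k ih] i j; first exact: cst_continuous.
rewrite (_ : (fun t => _) = fun t => \int[mu]_(s in `[a, t]) (B s *m picard_term k s) i j).
  by apply: continuous_Rintegral; exact: continuous_mulmx_coord.
by apply/funext => t; rewrite mxE.
Qed.

(** For n = 0 the entrywise bound is vacuous and [M] may be negative, whence the maximum with 0. *)
Let M0 : 0 <= Num.max M 0. Proof. by rewrite le_max lexx orbT. Qed.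

(* In the weighted norm sup_t |Y(t)| / E(t) the Picard operator halves, because
   the growth rate c of E is at least twice the bound n * M on B. *)
Let c : R := 2 * n%:R * Num.max M 0 + 1.

Let c0 : 0 < c.
Proof. by rewrite ltr_wpDl// !mulr_ge0. Qed.

Let E (t : R) : R := expR (c * (Num.max t a - a)).

Let E0 t : 0 < E t. Proof. exact: expR_gt0. Qed.

Let E_homo : {homo E : s t / s <= t}.
Proof.
move=> s t st; rewrite /E ler_expR; apply: ler_wpM2l; first exact: ltW.
by rewrite lerD2r ge_max !le_max st lexx orbT.
Qed.

Lemma norm_mulmx_coord_le (b : R) (A C : 'M[R]_n) i j :
  (forall i j, `|A i j| <= M) -> (forall i j, `|C i j| <= b) ->
  `|(A *m C) i j| <= n%:R * Num.max M 0 * b.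
Proof.
move=> AM Cb; rewrite mxE (le_trans (ler_norm_sum _ _ _))//.
rewrite -mulrA mulr_natl -[in leRHS](card_ord n) -sumr_const.
by apply: ler_sum => k _; rewrite normrM ler_pM// le_max AM.
Qed.

Lemma picard_term_le k t i j : `|picard_term k t i j| <= 2^-1 ^+ k * E t.
Proof.
elim: k t i j => [|k ih] t i j.
  rewrite expr0 mul1r [picard_term _ _ _ _]mxE; apply: (@le_trans _ _ 1).
    by case: (i == j); rewrite ?normr1 ?normr0.
  by rewrite -expR0 ler_expR mulr_ge0 ?(ltW c0)// subr_ge0 le_max lexx orbT.
rewrite [picard_term _ _ _ _]mxE; have [ta|at_] := leP t a.
  rewrite (_ : Rintegral _ _ _ = 0) ?normr0 ?mulr_ge0 ?exprn_ge0 ?(ltW (E0 _))//.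
  move: ta; rewrite le_eqVlt => /predU1P[->|ta].
    by rewrite set_itv1 Rintegral_set1.
  by rewrite set_itv_ge ?Rintegral_set0// bnd_simp -ltNge.
have cBp := @continuous_mulmx_coord _ i j (@continuous_picard_term k).
pose K := n%:R * Num.max M 0 * 2^-1 ^+ k.
have K0 : 0 <= K by rewrite /K !mulr_ge0// exprn_ge0.
have cexp (C : R) : continuous (fun s : R => C * expR (c * (s - a))).
  move=> s; apply: cvgM; first exact: cvg_cst.
  apply: continuous_comp; last exact: continuous_expR.
  apply: cvgM; first exact: cvg_cst.
  by apply: cvgB; [exact: cvg_id|exact: cvg_cst].
apply: le_trans (le_normr_Rintegral _ _) _ => //.
  exact: continuous_integrable_itv.
apply: (@le_trans _ _ (\int[mu]_(s in `[a, t]) (K * expR (c * (s - a))))).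
  apply: le_Rintegral => //.
  - apply: (@continuous_integrable_itv _ (fun s => `|_|)) => s.
    by apply: cvg_norm; exact: cBp.
  - exact: continuous_integrable_itv.
  - move=> s /= /[!in_itv]/= /andP[as_ st].
    apply: le_trans (norm_mulmx_coord_le _ _ (BM s) (ih s)) _.
    by rewrite /K /E (max_l as_) !mulrA.
have dexp (s : R) : is_derive s 1 (fun s : R => K / c * expR (c * (s - a))) (K * expR (c * (s - a))).
  apply: is_derive_eq.
  by rewrite subr0 /GRing.scale/=; field; rewrite gt_eqF.
rewrite /Rintegral (@continuous_FTC2 _ _ (fun s => K / c * expR (c * (s - a))))//; last first.
- by move=> s _; rewrite derive1E; apply: derive_val.
- split => [s _||]; first by case: (dexp s).
    by apply: cvg_at_right_filter; exact: cexp.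
  by apply: cvg_at_left_filter; exact: cexp.
- exact: continuous_subspaceT.
(* The lower endpoint contributes [- (K / c)], which is dropped; then [K / c] is at most
   [2^-1 ^+ k.+1] by the choice of [c]. *)
rewrite /= subrr mulr0 expR0 mulr1 /E (max_l (ltW at_)).
apply: (@le_trans _ _ (K / c * expR (c * (t - a)))).
  by rewrite gerDl oppr_le0 divr_ge0// ltW.
rewrite ler_wpM2r ?expR_ge0// ler_pdivrMr// /K /c exprS.
have : 0 <= 2^-1 ^+ k :> R by rewrite exprn_ge0.
by set u := _ ^+ k; lra.
Qed.

Definition picard_sum k t : 'M[R]_n := \sum_(l < k) picard_term l t.

Lemma continuous_picard_sum k i j : continuous (fun t => picard_sum k t i j).
Proof.
rewrite (_ : (fun t => _) = fun t => \sum_(l < k) picard_term l t i j); last first.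
  by apply/funext => t; rewrite summxE.
move=> t; apply: (@cvg_sum_ord _ _ (nbhs t)) => l; exact: continuous_picard_term.
Qed.

Lemma picard_sumS k t i j : picard_sum k.+1 t i j =
  (i == j)%:R + \int[mu]_(s in `[a, t]) (B s *m picard_sum k s) i j.
Proof.
elim: k => [|k ih].
  rewrite /picard_sum big_ord_recr big_ord0 /= add0r mxE.
  under eq_Rintegral do rewrite big_ord0 mulmx0 mxE.
  by rewrite Rintegral_cst// mul0r addr0.
rewrite /picard_sum big_ord_recr/= mxE -/(picard_sum _ _) ih.
rewrite [X in _ + X]mxE -addrA -RintegralD//; last 2 first.
- by apply: continuous_integrable_itv; apply: continuous_mulmx_coord => ? ?; exact: continuous_picard_sum.
- by apply: continuous_integrable_itv; apply: continuous_mulmx_coord => ? ?; exact: continuous_picard_term.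
congr (_ + _); apply: eq_Rintegral => s _.
by rewrite [in RHS]big_ord_recr/= mulmxDr [in RHS]mxE.
Qed.

(** With the factor [1 - 2^-1 ^+ l], adding the bound [2^-1 ^+ (k + l) * E t] of the next term
    closes the induction with equality; the bare bound [2 * 2^-1 ^+ k * E t] would not be
    inductive. *)
Lemma picard_sum_tail k l t i j :
  `|picard_sum (k + l) t i j - picard_sum k t i j| <=
  2 * 2^-1 ^+ k * E t * (1 - 2^-1 ^+ l).
Proof.
elim: l => [|l ih]; first by rewrite addn0 subrr normr0 expr0 subrr mulr0.
rewrite addnS {1}/picard_sum big_ord_recr/= mxE -/(picard_sum _ _) addrAC.
apply: le_trans (ler_normD _ _) _.
apply: (le_trans (lerD ih (picard_term_le _ _ _ _))).
rewrite exprD [in leRHS]exprS; set u := _ ^+ k; set v := _ ^+ l.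
lra.
Qed.


Let half_cvg (K : R) : K * 2^-1 ^+ k @[k --> \oo] --> 0.
Proof. by apply: cvg_geometric; rewrite gtr0_norm// invf_lt1// ltr1n. Qed.

Lemma linear_ode : exists Y : R -> 'M[R]_n,
  [/\ forall t, t <= a -> Y t = 1%:M, forall i j, continuous (fun t => Y t i j)
    & forall t i j, a < t ->
        is_derive t (1 : R) (fun t => Y t i j) ((B t *m Y t) i j)].
Proof.
pose Y t := \matrix_(i, j) limn (fun k => picard_sum k t i j) : 'M[R]_n.
have cvY t i j : picard_sum k t i j @[k --> \oo] --> Y t i j.
  rewrite mxE.
  have -> : (fun k => picard_sum k t i j) = series (fun l => picard_term l t i j).
    by apply/funext => k; rewrite /series/= big_mkord summxE.
  apply: normed_cvg; apply: (@series_le_cvg _ _ (geometric (E t) 2^-1)) => //.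
  - by move=> k /=.
  - by move=> k; rewrite /geometric/= mulr_ge0 ?exprn_ge0 ?(ltW (E0 _)).
  - by move=> k; rewrite /geometric/= mulrC; exact: picard_term_le.
  - by apply: is_cvg_geometric_series; rewrite gtr0_norm// invf_lt1// ltr1n.
have distY k t i j : `|Y t i j - picard_sum k t i j| <= 2 * 2^-1 ^+ k * E t.
  have cvD : `|picard_sum (k + l) t i j - picard_sum k t i j| @[l --> \oo] -->
      `|Y t i j - picard_sum k t i j|.
    apply: cvg_norm; apply: cvgB; last exact: cvg_cst.
    under eq_cvg do rewrite addnC.
    by have := cvY t i j; rewrite -(cvg_shiftn k).
  apply: (cvgr_to_le cvD); apply: nearW => l.
  rewrite (le_trans (picard_sum_tail _ _ _ _ _))// -[leRHS]mulr1.
  by rewrite ler_wpM2l ?gerBl ?exprn_ge0// !mulr_ge0 ?exprn_ge0 ?(ltW (E0 _)).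
(* The partial sums converge uniformly on times up to t + 1, where [E] is at most [E (t + 1)]; an
   e/3 argument concludes. *)
have cY i j : continuous (fun t => Y t i j).
  move=> t; apply/cvgrPdist_le => e e0.
  have e3 : 0 < e / 3 by rewrite divr_gt0.
  have /cvgrPdist_le/(_ _ e3)[k _ /(_ k (leqnn k))] := half_cvg (2 * E (t + 1)).
  rewrite sub0r normrN ger0_norm ?mulr_ge0 ?exprn_ge0 ?(ltW (E0 _))// => ke.
  have /cvgrPdist_le/(_ _ e3) := @continuous_picard_sum k i j t.
  apply: filter_app; near=> s => ps.
  have dk r : r <= t + 1 -> `|Y r i j - picard_sum k r i j| <= e / 3.
    move=> rt; apply: le_trans (distY _ _ _ _) _; apply: le_trans ke.
    by rewrite mulrAC ler_wpM2r ?exprn_ge0// ler_wpM2l// E_homo.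
  have dt : `|Y t i j - picard_sum k t i j| <= e / 3 by apply: dk; rewrite lerDl.
  have ds : `|Y s i j - picard_sum k s i j| <= e / 3.
    by apply: dk; apply/ltW; near: s; apply: lt_nbhsl; rewrite ltrDl.
  move: dt ds ps; rewrite !ler_norml.
  set yt := Y t i j; set ys := Y s i j; set a1 := picard_sum k t i j; set a2 := picard_sum k s i j.
  lra.
have intY t i j : Y t i j = (i == j)%:R + \int[mu]_(s in `[a, t]) (B s *m Y s) i j.
  apply/eqP; rewrite -subr_eq0 -normr_le0.
  pose len := fine (mu `[a, t]).
  (* Two errors are collected: [distY k.+1], whose factor 2 is absorbed by the extra power of one
     half, and the integral of [B] times the distance from [Y] to [picard_sum k], over an interval
     of length [len]. *)
  apply: (cvgr_to_ge (half_cvg (E t + n%:R * Num.max M 0 * (2 * E t) * len))).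
  apply: nearW => k.
  have cBY := @continuous_mulmx_coord Y i j cY.
  have cBS := @continuous_mulmx_coord (picard_sum k) i j (@continuous_picard_sum k).
  have := distY k.+1 t i j; rewrite picard_sumS => dY.
  have dI : `|\int[mu]_(s in `[a, t]) (B s *m picard_sum k s) i j -
      \int[mu]_(s in `[a, t]) (B s *m Y s) i j| <=
      n%:R * Num.max M 0 * (2 * 2^-1 ^+ k * E t) * len.
    rewrite -RintegralB//; [|exact: continuous_integrable_itv..].
    have cD : continuous (fun s => (B s *m picard_sum k s) i j - (B s *m Y s) i j).
      by move=> s; apply: cvgB; [exact: cBS|exact: cBY].
    apply: le_trans (le_normr_Rintegral _ _) _ => //; first exact: continuous_integrable_itv.
    rewrite /len -Rintegral_cst//; apply: le_Rintegral => //.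
    - by apply: (@continuous_integrable_itv _ (fun s => `|_|)) => s; apply: cvg_norm; exact: cD.
    - by apply: continuous_integrable_itv => s; exact: cvg_cst.
    - move=> s /= /[!in_itv]/= /andP[_ st].
      have -> : (B s *m picard_sum k s) i j - (B s *m Y s) i j =
          (B s *m (picard_sum k s - Y s)) i j by rewrite mulmxBr [in RHS]mxE [X in _ = _ + X]mxE.
      apply: norm_mulmx_coord_le (BM s) _ => i' j'.
      rewrite [X in `|X|]mxE [X in _ + X]mxE distrC (le_trans (distY _ _ _ _))//.
      by rewrite ler_wpM2l ?E_homo// mulr_ge0// exprn_ge0.
  rewrite exprS in dY; apply: le_trans.
    rewrite (_ : _ - _ = (Y t i j - ((i == j)%:R + \int[mu]_(s in `[a, t]) (B s *m picard_sum k s) i j)) +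
      (\int[mu]_(s in `[a, t]) (B s *m picard_sum k s) i j - \int[mu]_(s in `[a, t]) (B s *m Y s) i j)).
      exact: ler_normD.
    by ring.
  apply: le_trans (lerD dY dI) _.
  by rewrite le_eqVlt; apply/orP; left; apply/eqP; field.
exists Y; split => //.
- move=> t ta; apply/matrixP => i j; rewrite intY mxE.
  move: ta; rewrite le_eqVlt => /predU1P[->|ta].
    by rewrite set_itv1 Rintegral_set1 addr0.
  by rewrite set_itv_ge ?Rintegral_set0 ?addr0// bnd_simp -ltNge.
- move=> t i j at_.
  rewrite (_ : (fun t => _) = cst (i == j)%:R + (fun t => \int[mu]_(s in `[a, t]) (B s *m Y s) i j)); last first.
    by apply/funext => s; rewrite intY.
  rewrite -[X in is_derive _ _ _ X]add0r; apply: is_deriveD.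
  exact: is_derive_Rintegral (@continuous_mulmx_coord Y i j cY) at_.
Unshelve. all: by end_near. Qed.

End LinearODE.

(* H is the transpose of the solution of K' = - A^T K, and the derivative of H G
   vanishes when G' = A G. *)
Lemma adjoint_fundamental_matrix (R : realType) n (A : R -> 'M[R]_n) (a M : R) :
  (forall i j, continuous (fun t => A t i j)) ->
  (forall t i j, `|A t i j| <= M) ->
  exists H : R -> 'M[R]_n,
    [/\ forall i j, continuous (fun t => H t i j),
        forall t i j, a < t ->
          is_derive t (1 : R) (fun t => H t i j) ((- (H t *m A t)) i j)
      & forall t, H t \in unitmx].
Proof.
move=> cA AM.
have [G [Ga cG dG]] := linear_ode a cA AM.
have [||K [Ka cK dK]] := @linear_ode R n (fun t => - (A t)^T) a M.
- move=> i j; rewrite (_ : (fun t => _) = fun t => - A t j i).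
    by move=> t; apply: cvgN; exact: cA.
  by apply/funext => t; rewrite !mxE.
- by move=> t i j; rewrite !mxE normrN.
pose H t := (K t)^T.
have cH i j : continuous (fun t => H t i j).
  rewrite (_ : (fun t => _) = fun t => K t j i); first exact: cK.
  by apply/funext => t; rewrite mxE.
have dH t i j : a < t -> is_derive t (1 : R) (fun t => H t i j) ((- (H t *m A t)) i j).
  move=> at_; rewrite (_ : (fun t => _) = fun t => K t j i); last first.
    by apply/funext => s; rewrite mxE.
  have -> : - (H t *m A t) = (- (A t)^T *m K t)^T by rewrite mulNmx linearN/= trmx_mul trmxK.
  by rewrite mxE; exact: dK.
exists H; split => // t; have [ta|at_] := leP t a.
  by rewrite /H Ka// trmx1 unitmx1.
suff HG : H t *m G t = 1%:M by case: (mulmx1_unit HG).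
have HGa : H a *m G a = 1%:M by rewrite /H Ka// Ga// trmx1 mulmx1.
rewrite -HGa; apply/matrixP => i j; apply/eqP; rewrite -subr_eq0; apply/eqP.
have HGE : (fun s => (H s *m G s) i j) = \sum_k (fun s => H s i k * G s k j).
  by apply/funext => s; rewrite mxE fct_sumE.
have [||c _ ->] := @MVT_segment R (fun s => (H s *m G s) i j) (fun=> 0) a t (ltW at_).
- move=> s /[!in_itv]/= /andP[as_ _]; rewrite HGE.
  apply: is_derive_eq.
    apply: is_derive_sum => k.
    exact: (@is_deriveM _ _ (fun s => H s i k) (fun s => G s k j) s 1 _ _ (dH _ _ _ as_) (dG _ _ _ as_)).
  rewrite big_split/=.
  transitivity ((H s *m (A s *m G s)) i j + (- (H s *m A s) *m G s) i j).
    by congr (_ + _); rewrite [RHS]mxE; apply: eq_bigr => k _; rewrite // mulrC.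
  by rewrite mulNmx mulmxA [X in _ + X]mxE subrr.
- apply: continuous_subspaceT => s; rewrite HGE.
  rewrite fct_sumE; apply: (@cvg_sum_ord _ _ (nbhs s)) => k.
  by apply: cvgM; [exact: cH|exact: cG].
- by rewrite mul0r.
Qed.

(** * The sphere and W1 *)

Section SphereTopology.
Context {R : realType} {d : nat}.
Local Notation S := (sphere R d).
Local Notation V := ('cV[R]_d.+1).

Lemma val_sphere_continuous : continuous (val : S -> V).
Proof. exact: (@initial_continuous (set_type (@usphere R d)) V set_val). Qed.

Lemma enorm_val_sphere (x : S) : enorm (val x) = 1.
Proof. by case: x => y /= yP; apply/set_mem. Qed.

Lemma val_sphere_neq0 (x : S) : val x != 0.
Proof. by rewrite -enorm_eq0 enorm_val_sphere oner_neq0. Qed.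

Lemma coord_le_enorm n (x : 'cV[R]_n) i : `|x i 0| <= enorm x.
Proof.
rewrite /enorm -sqrtr_sqr ler_wsqrtr// (bigD1 i)//= lerDl sumr_ge0// => j _.
exact: sqr_ge0.
Qed.

Lemma mx_norm_le_enorm n (x : 'cV[R]_n) : `|x| <= enorm x.
Proof.
rewrite [leLHS]/Num.Def.normr/= mx_normrE (bigmax_le _ (enorm_ge0 _))//= => -[i j] _ /=.
by rewrite (ord1 j) coord_le_enorm.
Qed.

Lemma trmx_continuous m n : continuous (@trmx R m n).
Proof.
move=> x; apply: (@mx_cvg_coord _ _ (nbhs x)) => i j; rewrite mxE.
under eq_cvg do rewrite mxE.
exact: coord_continuous.
Qed.

Lemma compact_usphere : compact (@usphere R d).
Proof.
(* Heine-Borel is applied to row vectors, hence the transposition. *)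
have -> : @usphere R d = trmx @` (trmx @^-1` (@usphere R d) : set 'rV[R]_d.+1).
  apply/seteqP; split=> [x Sx|_ [y Sy <-]//].
  by exists x^T; rewrite /= trmxK.
apply: continuous_compact; first exact/continuous_subspaceT/trmx_continuous.
apply: bounded_closed_compact.
  exists 1; split => // M M1 x /= xS; apply/ltW; apply: le_lt_trans M1.
  have -> : `|x| = `|x^T|.
    rewrite /Num.Def.normr/= !mx_normrE.
    rewrite (reindex (fun p : 'I_d.+1 * 'I_1 => (p.2, p.1)))/=.
      by apply: eq_bigr => i _; rewrite mxE.
    by exists (fun p => (p.2, p.1)) => -[].
  by rewrite -xS mx_norm_le_enorm.
apply: preimage_closed; first by move=> ? _; exact: trmx_continuous.
rewrite (_ : @usphere R d = enorm @^-1` [set 1]); last by apply/seteqP; split.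
apply: preimage_closed; first by move=> ? _; exact: enorm_continuous.
exact: closed_eq.
Qed.

(** This is compactness of [usphere] in near-covering form, the source of all uniformity over the
    sphere: boundedness when [F] is the filter at infinity, uniform continuity when it is the right
    filter at 0, uniform convergence in general. *)
Lemma sphere_near_covering (I : Type) (F : set_system I) (P : I -> S -> Prop) :
  Filter F ->
  (forall x : S, \forall x' \near x & i \near F, P i x') ->
  \forall i \near F, forall x, P i x.
Proof.
move=> FF FP.
have /compact_near_coveringP/(_ _ F (fun i y => forall x : S, val x = y -> P i x) FF) cS := compact_usphere.
have {cS} : \forall i \near F, (@usphere R d) `<=` (fun y => forall x : S, val x = y -> P i x).
  apply: cS => y Sy.
  have [[/= U V] [Ux FV] UVP] := FP (exist _ y (mem_set Sy) : set_type (@usphere R d)).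
  have [_ [[W oW <-] Wy WU]] := Ux.
  exists (W, V) => /=; first by split => //; exact: open_nbhs_nbhs.
  move=> [z i] /= [Wz Vi] x xz; apply: (UVP (x, i)); split => //=.
  by move: Wz; rewrite -xz => Wx; exact: WU.
by apply: filterS => i iP x; apply: (iP (val x)) => //; exact: enorm_val_sphere.
Qed.

Lemma continuous_sphere_measurable (f : S -> R) : continuous f ->
  measurable_fun setT (f : borelType S -> R).
Proof.
move=> /continuousP cf.
apply: (measurability _ (RGenOpens.measurableE R)) => //.
move=> _ [_ [a [b ->]] <-]; rewrite setTI; apply: open_borel; apply: cf.
exact: interval_open.
Qed.

Lemma continuous_sphere_bounded (f : S -> R) : continuous f ->
  exists2 M : R, 0 <= M & forall x, `|f x| <= M.
Proof.
move=> cf.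
have : \forall M \near +oo, forall x, `|f x| <= M.
  apply: sphere_near_covering => x.
  have fx : \forall x' \near x, `|f x'| <= `|f x| + 1.
    have /cvgrPdist_le/(_ 1 ltr01) := cf x.
    apply: filterS => x' fx'.
    have -> : f x' = f x - (f x - f x') by rewrite opprB addrC subrK.
    by apply: le_trans (ler_normB _ _) _; rewrite lerD2l.
  exists ([set x' | `|f x'| <= `|f x| + 1], [set M | `|f x| + 1 <= M]).
    by split => //=; apply: nbhs_pinfty_ge; rewrite num_real.
  by move=> [x' M] /= [] ; exact: le_trans.
move=> fM; near (+oo : set_system R) => M.
exists M; last by near: M.
by near: M; apply: nbhs_pinfty_ge; rewrite num_real.
Unshelve. all: by end_near. Qed.

Lemma bounded_integrable (d' : measure_display) (T : measurableType d')
    (P : probability T R) (f : T -> R) (M : R) :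
  measurable_fun setT f -> (forall x, `|f x| <= M) -> P.-integrable setT (EFin \o f).
Proof.
move=> mf fM; apply: measurable_bounded_integrable => //.
  exact: le_lt_trans (probability_le1 P measurableT) (ltry 1).
by exists M; split; rewrite ?num_real// => K MK x _ /=; rewrite (le_trans (fM x))// ltW.
Qed.

Lemma continuous_sphere_integrable (mu : prob_sphere R d) (f : S -> R) :
  continuous f -> mu.-integrable setT (EFin \o f).
Proof.
move=> cf; have [M _ fM] := continuous_sphere_bounded cf.
exact: bounded_integrable (continuous_sphere_measurable cf) fM.
Qed.

(* Transfers W1 estimates, which concern Lipschitz functions, to continuous ones. *)
Lemma continuous_sphere_modulus (f : S -> R) (e : R) : continuous f -> 0 < e ->
  exists2 C : R, 0 <= C & forall x y, `|f x - f y| <= e + C * enorm (val x - val y).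
Proof.
move=> cf e0; have [M M0 fM] := continuous_sphere_bounded cf.
have [D D0 fD] : exists2 D : R, 0 < D &
    forall x y : S, `|val x - val y| < D -> `|f x - f y| <= e.
  have e2 : 0 < e / 2 by rewrite divr_gt0.
  have : \forall D \near 0^'+, forall x y : S, `|val x - val y| < D -> `|f x - f y| <= e.
    apply: sphere_near_covering => x.
    have : \forall x' \near x, `|f x - f x'| <= e / 2.
      by have /cvgrPdist_le/(_ _ e2) := cf x.
    move=> [_ [[W oW <-] Wx WU]].
    have /nbhs_ballP[r /= r0 rW] : nbhs (val x) W by exact: open_nbhs_nbhs.
    have r2 : 0 < r / 2 by rewrite divr_gt0.
    have near_x y : `|val x - val y| < r -> `|f x - f y| <= e / 2.
      by move=> xy; apply: WU; rewrite /= set_valE; apply: rW; rewrite -ball_normE.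
    exists ([set x' | `|val x - val x'| < r / 2], [set D | D < r / 2]).
      split => /=; last exact: nbhs_right_lt.
      by have /cvgrPdist_lt/(_ _ r2) := @val_sphere_continuous x.
    move=> [x' D] /= [xx' Dr] y xy.
    have fx' := near_x x' (lt_trans xx' _).
    have fy : `|f x - f y| <= e / 2.
      apply: near_x; apply: le_lt_trans (ler_distD (val x') _ _) _.
      by rewrite [ltRHS]splitr ltrD// (lt_trans xy).
    apply: le_trans (ler_distD (f x) _ _) _.
    rewrite [leRHS]splitr lerD// distrC fx'//.
    by rewrite ltr_pdivrMr// ltr_pMr// ltr1n.
  move=> fD; near (0 : R)^'+ => D; exists D => //.
  by near: D.
(* At sup-norm distance at least [D], the values of [f] differ by at most 2 M, which [2 * M / D]
   times the distance already covers. *)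
exists (2 * M / D); first by rewrite divr_ge0 ?mulr_ge0// ltW.
move=> x y; have [xy|xy] := ltP `|val x - val y| D.
  apply: le_trans (fD _ _ xy) _; rewrite lerDl mulr_ge0 ?enorm_ge0//.
  by rewrite divr_ge0 ?mulr_ge0// ltW.
apply: (@le_trans _ _ (2 * M)).
  by rewrite (le_trans (ler_normB _ _))// mulr_natl mulr2n lerD.
apply: (@le_trans _ _ (2 * M / D * D)); first by rewrite divfK// gt_eqF.
rewrite ler_wpDl ?(ltW e0)// ler_wpM2l ?divr_ge0 ?mulr_ge0 ?(ltW D0)//.
by rewrite (le_trans xy)// mx_norm_le_enorm.
Unshelve. all: by end_near. Qed.


(** The source carries the product of two Borel sigma-algebras, so measurability is built from the
    coordinates rather than read off from continuity on the product space. *)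
Lemma measurable_sphere_dist :
  measurable_fun setT (fun z : borelType S * borelType S => enorm (val z.1 - val z.2)).
Proof.
have mcoord i : measurable_fun setT (fun x : borelType S => (val x : V) i 0).
  apply: (@continuous_sphere_measurable (fun x => (val x : V) i 0)) => x.
  apply: (@continuous_comp _ _ _ (val : S -> V) (fun y : V => y i 0)).
    exact: val_sphere_continuous.
  exact: coord_continuous.
rewrite (_ : (fun z => _) = Num.sqrt \o (fun z : borelType S * borelType S =>
    \sum_i ((val z.1 - val z.2) : V) i 0 ^+ 2))//.
apply: measurableT_comp; first by apply: continuous_measurable_fun; exact: sqrt_continuous.
apply: measurable_sum => i; apply: measurable_funX.
rewrite (_ : (fun z => _) = fun z : borelType S * borelType S => (val z.1 : V) i 0 - (val z.2 : V) i 0); last first.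
  by apply/funext => z; rewrite !mxE.
apply: measurable_funB.
  exact: (@measurableT_comp _ _ _ _ _ _ (fun x : borelType S => (val x : V) i 0) _ fst).
exact: (@measurableT_comp _ _ _ _ _ _ (fun x : borelType S => (val x : V) i 0) _ snd).
Qed.

Lemma Rintegral_coupling (mu nu : prob_sphere R d)
    (gamma : probability (borelType S * borelType S)%type R) (f : S -> R) :
  coupling mu nu gamma -> continuous f ->
  \int[mu]_x f x = \int[gamma]_z f z.1 /\ \int[nu]_x f x = \int[gamma]_z f z.2.
Proof.
move=> g cf; have mf := continuous_sphere_measurable cf.
have [M M0 fM] := continuous_sphere_bounded cf.
have key (mu' : prob_sphere R d) (p : borelType S * borelType S -> borelType S) :
    measurable_fun setT p ->
    (forall A : set (borelType S), measurable A -> gamma (p @^-1` A) = mu' A) ->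
    \int[mu']_x f x = \int[gamma]_z f (p z).
  move=> mp pE; rewrite /Rintegral; congr fine.
  rewrite (eq_measure_integral (pushforward gamma p)); last first.
    by move=> A mA _; rewrite /= /pushforward pE.
  rewrite integral_pushforward//; first exact/measurable_EFinP.
  rewrite preimage_setT.
  by apply: (@bounded_integrable _ _ gamma (f \o p) M) => [|z]; [exact: (measurableT_comp mf mp)|exact: fM].
split; apply: key => // A /g[+ +].
- by move=> <- _; congr (gamma _); apply/seteqP; split=> -[x y] //= [].
- by move=> _ <-; congr (gamma _); apply/seteqP; split=> -[x y] //= [].
Qed.

(** The easy half of Kantorovich duality, for functions that are Lipschitz up to an error [e]: the
    strict inequality supplies a coupling of cost below [w], on which both integrals are
    compared. *)
Lemma Rintegral_W1_le (mu nu : prob_sphere R d) (f : S -> R) (e C w : R) :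
  continuous f -> 0 <= e -> 0 <= C ->
  (forall x y, `|f x - f y| <= e + C * enorm (val x - val y)) ->
  (W1 mu nu < w%:E)%E ->
  `|\int[mu]_x f x - \int[nu]_x f x| <= e + C * w.
Proof.
move=> cf e0 C0 fe /ereal_inf_lt[_ [gamma g <-]] gw.
have [-> ->] := Rintegral_coupling g cf.
have mf := continuous_sphere_measurable cf.
have [M M0 fM] := continuous_sphere_bounded cf.
have ip (p : borelType S * borelType S -> borelType S) : measurable_fun setT p ->
    gamma.-integrable setT (EFin \o (f \o p)).
  by move=> mp; apply: (@bounded_integrable _ _ gamma (f \o p) M) => [|z]; [exact: (measurableT_comp mf mp)|exact: fM].
have i1 := ip fst measurable_fst.
have i2 := ip snd measurable_snd.
have iD : gamma.-integrable setT
    (EFin \o (fun z : borelType S * borelType S => enorm (val z.1 - val z.2))).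
  apply/integrableP; split; first by apply/measurable_EFinP; exact: measurable_sphere_dist.
  under eq_integral do rewrite /= ger0_norm ?enorm_ge0//.
  exact: lt_trans gw (ltry _).
have iC : gamma.-integrable setT
    (EFin \o (fun z : borelType S * borelType S => C * enorm (val z.1 - val z.2))).
  exact: (integrableZl measurableT C iD).
have ie : gamma.-integrable setT (EFin \o (fun z : borelType S * borelType S => e)).
  by apply: (@bounded_integrable _ _ gamma (fun=> e) `|e|).
have iB : gamma.-integrable setT
    (EFin \o (fun z : borelType S * borelType S => f z.1 - f z.2)).
  exact: (integrableB measurableT i1 i2).
rewrite -RintegralB//.
apply: le_trans (le_normr_Rintegral _ _) _ => //.
apply: (@le_trans _ _ (\int[gamma]_z (e + C * enorm (val z.1 - val z.2)))).
  apply: le_Rintegral => //.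
  - exact: integrable_abse iB.
  - exact: (integrableD measurableT ie iC).
rewrite RintegralD// Rintegral_cst// RintegralZl//.
rewrite lerD//.
  rewrite -[leRHS]mulr1 ler_wpM2l//.
  by rewrite [X in fine X](@probability_setT _ _ _ gamma).
rewrite ler_wpM2l// -lee_fin fineK//; last exact: integrable_fin_num.
exact: ltW.
Qed.

(** The error is split through the integral of [g] against [mu i]. By [sphere_near_covering] the
    joint convergence is uniform, which bounds the first part whatever the measure;
    [Rintegral_W1_le] bounds the second. *)
Lemma cvg_Rintegral_W1 (I : Type) (F : set_system I) (f : I -> S -> R) (g : S -> R)
    (mu : I -> prob_sphere R d) (nu : prob_sphere R d) : Filter F ->
  (forall i, continuous (f i)) -> continuous g ->
  (forall x, f p.1 p.2 @[p --> (F, nbhs x)] --> g x) ->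
  W1 (mu i) nu @[i --> F] --> 0%E ->
  \int[mu i]_x f i x @[i --> F] --> \int[nu]_x g x.
Proof.
move=> FF cf cg fg W0.
apply/cvgrPdist_le => e e0.
have e3 : 0 < e / 3 by rewrite divr_gt0.
have [C C0 gC] := continuous_sphere_modulus cg e3.
(* The thirds of [e] pay for uniform convergence, for the error in the modulus of [g], and for
   [C * w]; [C + 1] avoids dividing by 0. *)
pose w := e / 3 / (C + 1).
have w0 : 0 < w by rewrite divr_gt0// ltr_wpDl.
have Cw : C * w <= e / 3.
  rewrite /w mulrA ler_pdivrMr ?ltr_wpDl//.
  by rewrite mulrC ler_wpM2l ?lerDl// ltW.
have unif : \forall i \near F, forall x, `|f i x - g x| <= e / 3.
  apply: sphere_near_covering => x.
  have e6 : 0 < e / 3 / 2 by rewrite divr_gt0.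
  have /cvgrPdist_le/(_ _ e6)[[U V] /= [FU xV] UV] := fg x.
  have /cvgrPdist_le/(_ _ e6) xg := cg x.
  exists (V `&` [set x' | `|g x - g x'| <= e / 3 / 2], U) => /=.
    by split => //; exact: filterI.
  move=> [x' i] /= [[Vx' gx'] Ui].
  have /= := UV (i, x') (conj Ui Vx'); rewrite distrC => fgx.
  apply: le_trans (ler_distD (g x) _ _) _.
  by rewrite [leRHS]splitr lerD.
have Ww : \forall i \near F, (W1 (mu i) nu < w%:E)%E.
  apply: (W0 [set y | (y < w%:E)%E]).
  apply: open_nbhs_nbhs; split; last by rewrite /= lte_fin.
  exact: open_ereal_lt_ereal.
near=> i.
have fgi : `|\int[mu i]_x f i x - \int[mu i]_x g x| <= e / 3.
  have ifg : (mu i).-integrable setT (EFin \o (fun x => f i x - g x)).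
    apply: continuous_sphere_integrable => x; exact: (cvgB (cf i x) (cg x)).
  rewrite -RintegralB//; [|exact: continuous_sphere_integrable..].
  apply: le_trans (le_normr_Rintegral _ _) _ => //.
  apply: (@le_trans _ _ (\int[mu i]_x (e / 3))).
    apply: le_Rintegral => //.
    - exact: integrable_abse ifg.
    - by apply: (@bounded_integrable _ _ (mu i) (fun=> e / 3) `|e / 3|).
    - by move=> x _; apply: (near unif i _).
  by rewrite Rintegral_cst// [X in fine X](@probability_setT _ _ _ (mu i)) mulr1.
have ggi : `|\int[mu i]_x g x - \int[nu]_x g x| <= e / 3 + C * w.
  by apply: (Rintegral_W1_le cg (ltW e3) C0 gC); near: i.
rewrite distrC; apply: le_trans (ler_distD (\int[mu i]_x g x) _ _) _.
by apply: le_trans (lerD fgi ggi) _; lra.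
Unshelve. all: by end_near. Qed.

End SphereTopology.

(** * C^1 functions on the sphere *)

Lemma near_eq_is_diff (R : numFieldType) (V W : normedModType R) (f g : V -> W) (x : V) :
  (\near x, f x = g x) -> differentiable f x ->
  differentiable g x /\ 'd g x = 'd f x :> (V -> W).
Proof.
move=> fg df; have [cdf dfE] := (diff_locallyP _ _).1 df.
have dg : g \o shift x = cst (g x) + 'd f x +o_ 0 id.
  apply/eqaddoP => e e0; have /eqaddoP/(_ e e0) := dfE.
  have : \forall h \near (0 : V), f (h + x) = g (h + x).
    by move: fg; rewrite (near_shift 0 x); apply: filterS => h /=; rewrite subr0.
  apply: filter_app2; near=> h.
  by rewrite /= !fctE /= => ->; rewrite (nbhs_singleton fg).
have gE := diff_unique cdf dg.
split; last exact: gE.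
by apply/diff_locallyP; split; rewrite gE; [exact: cdf|exact: dg].
Unshelve. all: by end_near. Qed.

Lemma near_eq_diffE (R : numFieldType) (V W : normedModType R) (f g df : V -> W) (x v : V) :
  (\near x, f x = g x) -> is_diff x f df -> 'd g x v = df v.
Proof. by move=> fg [dfx <-]; have [_ ->] := near_eq_is_diff fg dfx. Qed.

Section DifferentiableOffZero.
Context {R : realType} {V : normedModType R}.
Implicit Types w : V -> R.

(** The origin is excluded because a function constant along rays has no limit there unless it is
    constant. *)
Definition C1_off0 w := forall y : V, y != 0 ->
  differentiable w y /\ forall v, {for y, continuous (fun z => 'd w z v)}.

Lemma near_neq0 (y : V) : y != 0 -> \forall z \near y, z != 0.
Proof.
move=> y0; have : open (~` [set (0 : V)]).
  exact/closed_openC/accessible_closed_set1/hausdorff_accessible/norm_hausdorff.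
move=> o0; apply: (@filterS _ _ _ (~` [set 0])); first by move=> z /eqP.
by apply: open_nbhs_nbhs; split => //; exact/eqP.
Qed.

Lemma C1_off0I w (dw : V -> V -> R) :
  (forall y : V, y != 0 -> is_diff y w (dw y)) ->
  (forall y : V, y != 0 -> forall v, {for y, continuous (fun z => dw z v)}) ->
  C1_off0 w.
Proof.
move=> wd dwc y y0; split; first by have [] := wd _ y0.
move=> v; have dE (z : V) : z != 0 -> 'd w z v = dw z v by move=> /wd[_ ->].
rewrite /prop_for /continuous_at dE//; apply: cvg_trans (dwc y y0 v).
apply: (@near_eq_cvg _ _ (nbhs y)); near=> z; rewrite dE//.
by near: z; exact: near_neq0.
Unshelve. all: by end_near.
Qed.

Lemma C1_off0_is_diff w (y : V) : C1_off0 w -> y != 0 -> is_diff y w ('d w y).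
Proof. by move=> wC /wC[+ _]; exact: differentiableP. Qed.

Lemma C1_off0_eq w1 w2 : (forall y : V, y != 0 -> w1 y = w2 y) -> C1_off0 w1 ->
  C1_off0 w2.
Proof.
move=> w12 wC; apply: (@C1_off0I _ (fun z v => 'd w1 z v)) => y y0; last first.
  by move=> v; have [_] := wC y y0; apply.
have w12y : \near y, w1 y = w2 y by apply: filterS (near_neq0 y0); exact: w12.
have [dw2 dE] := near_eq_is_diff w12y (wC y y0).1.
exact: DiffDef.
Qed.

Lemma C1_off0_cst (a : R) : C1_off0 (cst a).
Proof.
by apply: (@C1_off0I _ (fun=> (0 : V -> R))) => y y0 v; exact: cst_continuous.
Qed.

Lemma C1_off0D w1 w2 : C1_off0 w1 -> C1_off0 w2 -> C1_off0 (fun y => w1 y + w2 y).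
Proof.
move=> C1 C2; apply: (@C1_off0I _ (fun y v => 'd w1 y v + 'd w2 y v)) => y y0.
  exact: is_diffD (C1_off0_is_diff C1 y0) (C1_off0_is_diff C2 y0).
by move=> v; apply: cvgD; [apply: (C1 y y0).2|apply: (C2 y y0).2].
Qed.

Lemma C1_off0M w1 w2 : C1_off0 w1 -> C1_off0 w2 -> C1_off0 (fun y => w1 y * w2 y).
Proof.
move=> C1 C2.
apply: (@C1_off0I _ (fun y v => w1 y * 'd w2 y v + w2 y * 'd w1 y v)) => y y0.
  exact: is_diffM (C1_off0_is_diff C1 y0) (C1_off0_is_diff C2 y0).
move=> v; apply: cvgD; apply: cvgM.
- exact: differentiable_continuous (C1 y y0).1.
- by apply: (C2 y y0).2.
- exact: differentiable_continuous (C2 y y0).1.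
- by apply: (C1 y y0).2.
Qed.

Lemma C1_off0_sum m (f : 'I_m -> V -> R) :
  (forall i, C1_off0 (f i)) -> C1_off0 (fun y => \sum_i f i y).
Proof.
move=> fC; elim: (index_enum _) => [|i r ih].
  by apply: (C1_off0_eq _ (C1_off0_cst 0)) => y _; rewrite big_nil.
by apply: (C1_off0_eq _ (C1_off0D (fC i) ih)) => y _; rewrite big_cons.
Qed.

Lemma C1_off0_comp w (g g' : R -> R) : C1_off0 w ->
  (forall y : V, y != 0 -> is_derive (w y) (1 : R) g (g' (w y))) ->
  (forall y : V, y != 0 -> {for w y, continuous g'}) ->
  C1_off0 (g \o w).
Proof.
move=> wC dg cg'.
apply: (@C1_off0I _ (fun y v => g' (w y) * 'd w y v)) => y y0.
  have [gw gE] := dg y y0.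
  have dgw : differentiable g (w y) by exact/derivable1_diffP.
  apply: DiffDef; first exact: differentiable_comp (wC y y0).1 dgw.
  rewrite (diff_comp (wC y y0).1 dgw); apply/funext => v /=.
  by rewrite diff1E// derive1E gE mulrC.
move=> v; apply: cvgM; last by apply: (wC y y0).2.
apply: (@continuous_comp _ _ _ w g'); last exact: cg'.
exact: differentiable_continuous (wC y y0).1.
Qed.

Lemma C1_off0_linear (W : normedModType R) w (K : {linear W -> V}) :
  continuous K -> (forall y : W, y != 0 -> K y != 0) -> C1_off0 w ->
  forall y : W, y != 0 -> is_diff y (w \o K) (fun v => 'd w (K y) (K v)).
Proof.
move=> cK K0 wC y y0.
have dK : is_diff y K K by apply: DiffDef; [exact: linear_differentiable|rewrite diff_lin].
exact: (is_diff_comp dK (C1_off0_is_diff wC (K0 _ y0))).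
Qed.

(** Euler's relation in degree 0: y + h y is a positive multiple of y as soon as h > -1, so the
    difference quotients along y vanish near h = 0. *)
Lemma diff_homogeneous w (y : V) : (forall a, 0 < a -> w (a *: y) = w y) ->
  differentiable w y -> 'd w y y = 0.
Proof.
move=> wh dw; rewrite -deriveE//; apply: lim_near_cst => //=.
have : \forall h \near (0 : R)^', - 1 < h.
  by apply: nbhs_dnbhs; apply: lt_nbhsr; rewrite ltrN10.
apply: filterS => h h1 /=; rewrite -[X in w (_ + X)]scale1r -scalerDl.
by rewrite wh ?subrr ?scaler0// -ltrBlDr sub0r.
Qed.

Lemma diff_along_ray w (y u : V) (c : R) :
  (forall a, 0 < a -> w (a *: y) = w y) -> differentiable w y ->
  'd w y (u - c *: y) = 'd w y u.
Proof. by move=> wh dw; rewrite linearB linearZ/= diff_homogeneous// /GRing.scale/= mulr0 subr0. Qed.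

End DifferentiableOffZero.

Section C1Column.
Context {R : realType} {n : nat}.
Local Notation V := ('cV[R]_n.+1).

Lemma near_col_neq0 (y : V) : y != 0 -> \forall z \near y, z != 0.
Proof.
move=> y0; have : open (~` [set (0 : V)]).
  exact/closed_openC/accessible_closed_set1/hausdorff_accessible/norm_hausdorff.
move=> o0; apply: (@filterS _ _ _ (~` [set 0])); first by move=> z /eqP.
by apply: open_nbhs_nbhs; split => //; exact/eqP.
Qed.

Lemma C1_off0_coord i : C1_off0 (fun y : V => y i 0).
Proof.
have @f : {linear V -> R}.
  by exists (fun N : V => N i 0); do 2![eexists]; do ?[constructor];
     rewrite ?mxE// => ? *; rewrite ?mxE//; move=> ?; rewrite !mxE.
have cf : continuous f by exact: coord_continuous.
have df (y : V) : is_diff y f f.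
  by apply: DiffDef; [exact: linear_differentiable|rewrite diff_lin].
by apply: (@C1_off0I _ _ _ (fun _ => f)) => y y0 v; exact: cst_continuous.
Qed.

Lemma C1_off0_mulmx (w : V -> R) (K : 'M[R]_n.+1) : K \in unitmx -> C1_off0 w ->
  (forall y : V, y != 0 -> is_diff y (w \o mulmx K) (fun v => 'd w (K *m y) (K *m v))) /\
  C1_off0 (w \o mulmx K).
Proof.
move=> Ku wC.
have K0 (y : V) : y != 0 -> K *m y != 0.
  by apply: contra_neq => Ky0; rewrite -(mulKmx Ku y) Ky0 mulmx0.
have cK : continuous (mulmx K : V -> V) by exact: mulmx_continuous.
have key := @C1_off0_linear _ _ _ w (mulmx K : {linear V -> V}) cK K0 wC.
split; first exact: key.
apply: (@C1_off0I R V _ (fun y v => 'd w (K *m y) (K *m v)) key) => y y0 v.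
exact: (continuous_comp (cK y) ((wC _ (K0 _ y0)).2 (K *m v))).
Qed.

Lemma diff_sum_delta (w : V -> R) y v :
  'd w y v = \sum_i v i 0 * 'd w y (delta_mx i 0).
Proof.
rewrite {1}(matrix_sum_delta v) linear_sum; apply: eq_bigr => i _.
by rewrite big_ord1 linearZ.
Qed.

(** The inverse square root is composed with the squared norm, which is polynomial and positive off
    the origin. These functions extend the coordinates of the sphere, from which all test functions
    below are built. *)
Lemma C1_off0_normalize i : C1_off0 (fun y : V => (enorm y)^-1 * y i 0).
Proof.
pose q (y : V) := \sum_j y j 0 ^+ 2.
have qE y : enorm y ^+ 2 = q y by rewrite sqr_sqrtr// sumr_ge0// => j _; exact: sqr_ge0.
have q0 y : y != 0 -> 0 < q y.
  by rewrite -enorm_eq0 -qE => y0; rewrite exprn_gt0// lt_def y0 enorm_ge0.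
have qC : C1_off0 q.
  apply: C1_off0_sum => j; under eq_fun do rewrite expr2.
  by apply: C1_off0M; exact: C1_off0_coord.
apply: (@C1_off0M R V ((fun u => (Num.sqrt u)^-1) \o q)); last exact: C1_off0_coord.
pose g' (u : R) := - (Num.sqrt u) ^- 2 * (2 * Num.sqrt u)^-1.
apply: (@C1_off0_comp _ _ q _ g') => // y /q0 qy0.
  have s0 : Num.sqrt (q y) != 0 by rewrite gt_eqF// sqrtr_gt0.
  have [ds dsE] := is_derive1_sqrt qy0.
  apply: DeriveDef; first exact: derivableV.
  by rewrite deriveV// dsE.
have s0 : Num.sqrt (q y) != 0 by rewrite gt_eqF// sqrtr_gt0.
have cs : Num.sqrt u @[u --> q y] --> Num.sqrt (q y) by exact: sqrt_continuous.
rewrite /prop_for /continuous_at; apply: cvgM.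
  apply: cvgN; apply: cvgV; first by rewrite expf_eq0.
  by rewrite expr2; apply: cvgM.
apply: cvgV; first by rewrite mulf_neq0// pnatr_eq0.
by apply: cvgM => //; exact: cvg_cst.
Qed.

End C1Column.

Section C1Sphere.
Context {R : realType} {d : nat}.
Local Notation S := (sphere R d).
Local Notation V := ('cV[R]_d.+1).
Implicit Types phi : S -> R.

(** [C1_sphere] speaks of partial derivatives and [C1_off0] of all directions; linearity of the
    differential links the two. *)
Lemma C1_sphereP phi : C1_sphere phi <-> C1_off0 (radial_ext phi).
Proof.
split=> [phiC|phiC].
  apply: (@C1_off0I R V _ (fun z v => \sum_i v i 0 * 'D_(delta_mx i 0) (radial_ext phi) z)).
    move=> y y0; have [dphi _] := phiC y y0; apply: DiffDef => //.
    apply/funext => v; rewrite diff_sum_delta; apply: eq_bigr => i _.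
    by rewrite deriveE.
  move=> y y0 v; apply: (@cvg_sum_ord _ _ (nbhs y)) => i.
  apply: cvgM; first exact: cvg_cst.
  by have [_] := phiC y y0; apply.
move=> y y0; split; first by have [] := phiC y y0.
move=> i; have dE (z : V) : z != 0 -> 'D_(delta_mx i 0) (radial_ext phi) z = 'd (radial_ext phi) z (delta_mx i 0).
  by move=> z0; rewrite deriveE//; have [] := phiC z z0.
rewrite /prop_for /continuous_at dE//; apply: (cvg_trans _ ((phiC y y0).2 (delta_mx i 0))).
apply: (@near_eq_cvg _ _ (nbhs y)); near=> z; rewrite dE//.
by near: z; exact: near_col_neq0.
Unshelve. all: by end_near.
Qed.

Lemma Pi_scale (a : R) (y : V) : 0 < a -> y != 0 -> Pi (a *: y) = Pi y.
Proof.
move=> a0 y0; apply: val_inj; rewrite !val_Pi//; last first.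
  by rewrite scaler_eq0 negb_or gt_eqF.
rewrite enormZ gtr0_norm// invfM scalerA mulrAC mulVf ?mul1r// gt_eqF//.
Qed.

Lemma Pi_val (x : S) : Pi (val x) = x.
Proof.
by apply: val_inj; rewrite val_Pi ?val_sphere_neq0// enorm_val_sphere invr1 scale1r.
Qed.

Lemma Pi_neq0 (y : V) : y != 0 -> exists2 a : R, 0 < a & val (Pi y) = a *: y.
Proof.
move=> y0; exists (enorm y)^-1; last exact: val_Pi.
by rewrite invr_gt0 lt_def enorm_eq0 y0 enorm_ge0.
Qed.

Lemma radial_extZ phi (a : R) y : 0 < a -> y != 0 ->
  radial_ext phi (a *: y) = radial_ext phi y.
Proof. by move=> a0 y0; rewrite /radial_ext Pi_scale. Qed.

Lemma C1_sphere_continuous phi : C1_sphere phi -> continuous phi.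
Proof.
move=> /C1_sphereP phiC.
have -> : phi = radial_ext phi \o val by apply/funext => x /=; rewrite /radial_ext Pi_val.
move=> x; apply: continuous_comp; first exact: val_sphere_continuous.
apply: differentiable_continuous.
by have [] := phiC (val x) (val_sphere_neq0 x).
Qed.

Definition sphere_act (K : 'M[R]_d.+1) (x : S) : S := Pi (K *m val x).

(** Normalizing before applying [K] only changes the image by a positive factor. The projective
    action thus becomes a linear substitution in the extension, and the chain rule stays
    elementary. *)
Lemma radial_ext_act phi K y : K \in unitmx -> y != 0 ->
  radial_ext (phi \o sphere_act K) y = radial_ext phi (K *m y).
Proof.
move=> Ku y0; have [a a0 yE] := Pi_neq0 y0.
rewrite /radial_ext /= /sphere_act yE -scalemxAr Pi_scale//.
by apply: contra_neq y0 => Ky0; rewrite -(mulKmx Ku y) Ky0 mulmx0.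
Qed.

Lemma C1_sphere_act phi K : K \in unitmx -> C1_sphere phi ->
  C1_sphere (phi \o sphere_act K).
Proof.
move=> Ku /C1_sphereP phiC; apply/C1_sphereP.
apply: (@C1_off0_eq _ _ (radial_ext phi \o mulmx K)).
  by move=> y y0; rewrite radial_ext_act.
exact: (C1_off0_mulmx Ku phiC).2.
Qed.

Lemma velocityE (F : prob_sphere R d -> 'M[R]_d.+1) (mu : prob_sphere R d) (x : V) :
  velocity F x mu = F mu *m x - (x^T *m (F mu *m x)) 0 0 *: x.
Proof.
rewrite /velocity -mulmxA mulmxBl mul1mx -mulmxA; congr (_ - _).
by rewrite [X in x *m X]mx11_scalar mul_mx_scalar.
Qed.

Lemma sphere_grad_velocity phi K (F : prob_sphere R d -> 'M[R]_d.+1) (mu : prob_sphere R d) (x : S) :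
  K \in unitmx -> C1_sphere phi ->
  ((sphere_grad (phi \o sphere_act K) x)^T *m velocity F (val x) mu) 0 0 =
  'd (radial_ext phi) (K *m val x) (K *m (F mu *m val x)).
Proof.
move=> Ku phiC; have := C1_sphere_act Ku phiC; move/C1_sphereP : phiC => phiC /C1_sphereP phiKC.
have x0 := val_sphere_neq0 x.
have Kx0 : K *m val x != 0.
  by apply: contra_neq x0 => Ky0; rewrite -(mulKmx Ku (val x)) Ky0 mulmx0.
have dK := (C1_off0_mulmx Ku phiC).1 _ x0.
have near_act : \forall y \near (val x : V),
    (radial_ext phi \o mulmx K) y = radial_ext (phi \o sphere_act K) y.
  near=> y; rewrite [RHS]radial_ext_act//.
  by near: y; exact: near_col_neq0.
transitivity ('d (radial_ext (phi \o sphere_act K)) (val x) (velocity F (val x) mu)).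
  rewrite diff_sum_delta mxE; apply: eq_bigr => i _.
  by rewrite !mxE mulrC deriveE//; exact: (phiKC _ x0).1.
apply: (etrans (near_eq_diffE (velocity F (val x) mu) near_act dK)).
(* [K] sends the radial part of the velocity to a multiple of [K *m val x], the very point where the
   differential is taken, so Euler's relation removes it. *)
rewrite velocityE mulmxBr -scalemxAr; apply: diff_along_ray (phiC _ Kx0).1.
by move=> a a0; exact: radial_extZ.
Unshelve. all: by end_near. Qed.

Lemma C1_sphere_cst (a : R) : C1_sphere (fun _ : S => a).
Proof. by apply/C1_sphereP; exact: C1_off0_cst. Qed.

Lemma C1_sphereM phi psi : C1_sphere phi -> C1_sphere psi ->
  C1_sphere (fun x => phi x * psi x).
Proof.
move=> /C1_sphereP C1 /C1_sphereP C2; apply/C1_sphereP.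
exact: C1_off0_eq (C1_off0M C1 C2).
Qed.

Lemma C1_sphere_prod m (f : 'I_m -> S -> R) :
  (forall i, C1_sphere (f i)) -> C1_sphere (fun x => \prod_i f i x).
Proof.
move=> fC; elim: (index_enum _) => [|i r ih].
  by under eq_fun do rewrite big_nil; exact: C1_sphere_cst.
by under eq_fun do rewrite big_cons; exact: C1_sphereM.
Qed.

Lemma C1_sphere_comp phi (g g' : R -> R) : C1_sphere phi ->
  (forall u : R, is_derive u (1 : R) g (g' u)) -> continuous g' ->
  C1_sphere (g \o phi).
Proof.
move=> /C1_sphereP phiC dg cg'; apply/C1_sphereP.
by apply: (@C1_off0_comp _ _ (radial_ext phi) g g') => // y y0; exact: cg'.
Qed.

Lemma C1_sphere_coord i : C1_sphere (fun x : S => (val x : V) i 0).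
Proof.
apply/C1_sphereP; apply: (C1_off0_eq _ (C1_off0_normalize i)) => y y0.
by rewrite /radial_ext val_Pi// mxE.
Qed.

End C1Sphere.

(** * C^1 functions determine measures *)

Section PositivePart.
Context {R : realType}.

(** Squaring removes the corner of the positive part: at 0 the difference quotient is [Num.max h 0],
    which tends to 0. This yields compactly supported C^1 cutoffs. *)
Lemma is_derive_pos_sqr (u : R) :
  is_derive u (1 : R) (fun v : R => Num.max v 0 ^+ 2) (2 * Num.max u 0).
Proof.
have [u0|u0|->] := ltgtP u 0.
- rewrite mulr0; apply: (@near_eq_is_derive _ _ _ (cst 0)) => //.
  near=> v; rewrite /= max_r ?expr0n//; apply/ltW; near: v; exact: lt_nbhsl.
- apply: (@near_eq_is_derive _ _ _ (fun v : R => v ^+ 2)).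
    near=> v; rewrite max_l//; apply/ltW; near: v; exact: lt_nbhsr.
  by apply: is_derive_eq; rewrite /GRing.scale/=; ring.
- rewrite mulr0.
  have q0 : (fun h : R => h^-1 *: (((fun v : R => Num.max v 0 ^+ 2) \o shift 0) (h *: 1) -
      Num.max 0 0 ^+ 2)) @ 0^' --> (0 : R).
    apply: (@cvg_trans _ ((fun h : R => Num.max h 0) @ 0^')).
      apply: near_eq_cvg; near=> h.
      have h0 : h != 0 by near: h; exact: nbhs_dnbhs_neq.
      rewrite /= addr0 maxxx expr0n subr0 /GRing.scale/= mulr1.
      have [h1|h1] := leP h 0; first by rewrite expr0n mulr0.
      by rewrite expr2 mulKf.
    have c0 : Num.max h 0 @[h --> (0 : R)] --> Num.max (0 : R) 0.
      by apply: (@continuous_max _ _ idfun (cst 0)); [exact: cvg_id|exact: cvg_cst].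
    by rewrite maxxx in c0; apply: cvg_within_filter c0.
  by apply: DeriveDef; [apply/cvg_ex; exists 0|exact: cvg_lim].
Unshelve. all: by end_near. Qed.

Lemma continuous_pos_part : continuous (fun u : R => 2 * Num.max u 0).
Proof.
move=> u; apply: cvgM; first exact: cvg_cst.
by apply: (@continuous_max _ _ idfun (cst 0)); [exact: cvg_id|exact: cvg_cst].
Qed.

End PositivePart.

Section C1Determining.
Context {R : realType} {d : nat}.
Local Notation S := (sphere R d).
Implicit Types (mu nu : prob_sphere R d) (h phi : S -> R).

(** Cozero sets of C^1 functions suit Dynkin's theorem: products make them stable under
    intersection, and their indicators are limits of C^1 functions. *)
Definition nonvanishing_C1 : set (set S) :=
  [set A | exists2 h, C1_sphere h & A = [set x | h x != 0]].

Lemma nonvanishing_C1_setI : setI_closed nonvanishing_C1.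
Proof.
move=> _ _ [h hC ->] [k kC ->]; exists (fun x => h x * k x); first exact: C1_sphereM.
by apply/seteqP; split=> x /=; rewrite mulf_eq0 negb_or => /andP.
Qed.

Lemma nonvanishing_C1_open A : nonvanishing_C1 A -> open A.
Proof.
move=> [h /C1_sphere_continuous/continuousP ch ->].
rewrite (_ : mkset _ = h @^-1` (~` [set 0])).
  exact/ch/closed_openC/closed_eq.
by apply/seteqP; split=> x /= /eqP.
Qed.

(* Nonzero exactly on the sup-norm ball of center p.1 and radius 1 / (p.2 + 1). *)
Definition rational_box (p : 'cV[rat]_d.+1 * nat) : S -> R :=
  fun x => \prod_i Num.max (p.2.+1%:R^-1 ^+ 2 - ((val x : 'cV[R]_d.+1) i 0 - ratr (p.1 i 0)) ^+ 2) 0 ^+ 2.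

Lemma C1_rational_box p : C1_sphere (rational_box p).
Proof.
apply: C1_sphere_prod => i.
pose a : R := ratr (p.1 i 0); pose r : R := p.2.+1%:R^-1 ^+ 2.
apply: (@C1_sphere_comp _ _ _ (fun u : R => Num.max (r - (u - a) ^+ 2) 0 ^+ 2)
  (fun u => 2 * Num.max (r - (u - a) ^+ 2) 0 * (- (2 * (u - a)))) (C1_sphere_coord i)).
  move=> u; have dq : is_derive u (1 : R) (fun u : R => r - (u - a) ^+ 2) (- (2 * (u - a))).
    apply: is_derive_eq.
    by rewrite /GRing.scale/=; ring.
  exact: (@is_derive1_comp _ (fun v : R => Num.max v 0 ^+ 2) _ u _ _ (is_derive_pos_sqr _) dq).
have cs : continuous (fun u : R => u - a).
  by move=> v; apply: cvgB; [exact: cvg_id|exact: cvg_cst].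
have cq : continuous (fun u : R => r - (u - a) ^+ 2).
  move=> u; apply: cvgB; first exact: cvg_cst.
  by under eq_cvg do rewrite expr2; apply: cvgM; exact: cs.
move=> u; apply: cvgM; first exact: (continuous_comp (cq u) (@continuous_pos_part R _)).
by apply: cvgN; apply: cvgM; [exact: cvg_cst|exact: cs].
Qed.

Lemma rational_box_neq0 p x :
  (rational_box p x != 0) =
  [forall i, `|(val x : 'cV[R]_d.+1) i 0 - ratr (p.1 i 0)| < p.2.+1%:R^-1].
Proof.
have key (r t : R) : 0 < r -> (Num.max (r ^+ 2 - t ^+ 2) 0 ^+ 2 != 0) = (`|t| < r).
  move=> r0; rewrite sqrf_eq0 -(@ltr_pXn2r _ 2)// ?nnegrE ?(ltW r0)//.
  rewrite real_normK ?num_real// -subr_gt0.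
  by have [h|h] := leP (r ^+ 2 - t ^+ 2) 0; rewrite ?eqxx ?gt_eqF// ltNge h.
rewrite /rational_box; apply/prodf_neq0/forallP => [h i|h i _].
  by rewrite -key ?h// invr_gt0.
by rewrite key ?invr_gt0.
Qed.

Lemma open_rational_box (U : set S) (x : S) : open U -> U x ->
  exists p, rational_box p x != 0 /\ [set y | rational_box p y != 0] `<=` U.
Proof.
move=> [W oW <-] /= Wx.
have /nbhs_ballP[e /= e0 eW] : nbhs (val x : 'cV[R]_d.+1) W by exact: open_nbhs_nbhs.
have e2 : 0 < e / 2 by rewrite divr_gt0.
(* One half of [e] goes from the given point to the rational center, the other from the center to
   any point of the box. *)
have [k _ /(_ k (leqnn k)) /= ke] := near_infty_natSinv_lt (PosNum e2).
have k0 : 0 < k.+1%:R^-1 :> R by rewrite invr_gt0.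
have cP i : exists q : rat, `|(val x : 'cV[R]_d.+1) i 0 - ratr q| < k.+1%:R^-1.
  have /rat_in_itvoo[q] : (val x : 'cV[R]_d.+1) i 0 - k.+1%:R^-1 < (val x : 'cV[R]_d.+1) i 0 + k.+1%:R^-1.
    by rewrite ltrD2l gtrN.
  by rewrite in_itv/= => /andP[q1 q2]; exists q; rewrite distrC ltr_distl q1.
pose c := \col_i sval (cid (cP i)).
exists (c, k); split.
  by rewrite rational_box_neq0; apply/forallP => i /=; rewrite mxE; case: cid.
move=> y /=; rewrite rational_box_neq0 => /forallP /= yc; apply: eW; split => // i j.
rewrite (ord1 j) /ball/=.
apply: (le_lt_trans (ler_distD (ratr (c i 0)) _ _)).
rewrite [ltRHS]splitr ltrD//.
  by apply: lt_trans ke; rewrite mxE; case: cid.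
by rewrite distrC; apply: lt_trans ke; exact: yc.
Qed.

Lemma measurable_nonvanishing_C1 :
  @measurable _ (borelType S) = <<s nonvanishing_C1 >>.
Proof.
apply/seteqP; split; last first.
  apply: smallest_sub; first exact: sigma_algebra_measurable.
  by move=> A /nonvanishing_C1_open; exact: open_borel.
apply: smallest_sub; first exact: smallest_sigma_algebra.
move=> U oU; pose B p : set S := [set x | rational_box p x != 0].
(* Boxes not contained in [U] are replaced by the empty set, so that the union runs over a whole
   countable type. *)
have -> : U = \bigcup_(p : 'cV[rat]_d.+1 * nat) (if `[< B p `<=` U >] then B p else set0).
  apply/seteqP; split=> [x Ux|x [p _]].
    have [p [px pU]] := open_rational_box oU Ux.
    by exists p => //; case: asboolP.
  by case: asboolP => // + Bx; apply.
apply: (@countable_bigcupT_measurable _ (g_sigma_algebraType nonvanishing_C1)).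
  exact: countableP.
move=> p; case: asboolP => _; last exact: measurable0.
by apply: sub_sigma_algebra; exists (rational_box p) => //; exact: C1_rational_box.
Qed.

(* C^1 functions bounded by 1 converging to the indicator of h != 0. *)
Definition nonvanishing_approx h (n : nat) : S -> R :=
  fun x => 1 - (1 + n%:R * h x ^+ 2)^-1.

Lemma nonvanishing_approx_den (n : nat) (u : R) : 0 < 1 + n%:R * u ^+ 2.
Proof. by rewrite ltr_pwDl// mulr_ge0// sqr_ge0. Qed.

Lemma nonvanishing_approx_le h n x : `|nonvanishing_approx h n x| <= 1.
Proof.
rewrite /nonvanishing_approx ger0_norm.
  by rewrite gerBl invr_ge0 ltW// nonvanishing_approx_den.
rewrite subr_ge0 invf_le1 ?nonvanishing_approx_den// lerDl.
by rewrite mulr_ge0// sqr_ge0.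
Qed.

Lemma C1_nonvanishing_approx h n : C1_sphere h -> C1_sphere (nonvanishing_approx h n).
Proof.
move=> hC.
pose den (u : R) := 1 + n%:R * u ^+ 2.
have den0 u : den u != 0 by rewrite gt_eqF// nonvanishing_approx_den.
apply: (@C1_sphere_comp _ _ h (fun u : R => 1 - (den u)^-1)
  (fun u => (den u) ^- 2 * (n%:R * (2 * u)))) => //.
  move=> u.
  have dden : is_derive u (1 : R) den (n%:R * (2 * u)).
    by apply: is_derive_eq; rewrite /GRing.scale/=; ring.
  have dinv : is_derive u (1 : R) (fun v => (den v)^-1) (- (den u) ^- 2 * (n%:R * (2 * u))).
    have [d1 d2] := dden; apply: DeriveDef; first exact: derivableV.
    by rewrite deriveV// d2.
  have := is_deriveB (is_derive_cst (1 : R) u (1 : R)) dinv.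
  by rewrite sub0r mulNr opprK.
have cden : continuous den.
  move=> u; apply: cvgD; first exact: cvg_cst.
  apply: cvgM; first exact: cvg_cst.
  by under eq_cvg do rewrite expr2; apply: cvgM; exact: cvg_id.
move=> u; apply: cvgM.
  apply: cvgV; first exact: expf_neq0 (den0 u).
  by under eq_cvg do rewrite expr2; apply: cvgM; exact: cden.
by apply: cvgM; [exact: cvg_cst|apply: cvgM; [exact: cvg_cst|exact: cvg_id]].
Qed.

Lemma nonvanishing_approx_cvg h x :
  nonvanishing_approx h n x @[n --> \oo] --> (\1_[set x | h x != 0] x : R).
Proof.
rewrite /nonvanishing_approx indicE; have [hx|hx] := eqVneq (h x) 0.
  rewrite memNset/=; last by rewrite hx eqxx.
  under eq_cvg do rewrite hx expr0n mulr0 addr0 invr1 subrr.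
  exact: cvg_cst.
rewrite mem_set//= -[X in _ --> X]subr0; apply: cvgB; first exact: cvg_cst.
apply/gtr0_cvgV0; first by apply: nearW => n; exact: nonvanishing_approx_den.
have h2 : 0 < h x ^+ 2 by rewrite lt_def sqrf_eq0 hx sqr_ge0.
apply/cvgryPge => A; near=> n.
rewrite ler_wpDl// -ler_pdivrMr//.
by near: n; exact: nbhs_infty_ger.
Unshelve. all: by end_near. Qed.

Lemma nonvanishing_approx_Rintegral_cvg mu h : C1_sphere h ->
  \int[mu]_x nonvanishing_approx h n x @[n --> \oo] --> fine (mu [set x | h x != 0]).
Proof.
move=> hC; have mA : measurable ([set x | h x != 0] : set (borelType S)).
  by apply: open_borel; apply: nonvanishing_C1_open; rewrite /nonvanishing_C1/=; exists h.
have mf n : measurable_fun setT (nonvanishing_approx h n : borelType S -> R).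
  apply: continuous_sphere_measurable; apply: C1_sphere_continuous.
  exact: C1_nonvanishing_approx.
have [||||| _ _] := @dominated_convergence _ (borelType S) R mu setT measurableT
   (fun n x => (nonvanishing_approx h n x)%:E) (fun x => (\1_[set x | h x != 0] x)%:E) (cst 1%E).
- by move=> n; apply/measurable_EFinP.
- by apply/measurable_EFinP; exact: measurable_indic.
- apply: aeW => x _; apply: cvg_EFin; first exact: nearW.
  exact: nonvanishing_approx_cvg.
- by apply: (@bounded_integrable _ _ _ mu (fun=> 1) 1) => // x; rewrite normr1.
- by apply: aeW => x n _; rewrite /= lee_fin nonvanishing_approx_le.
rewrite integral_indic// setIT => cv.
by apply: fine_cvg; rewrite fineK// fin_num_measure.
Qed.

(** Dynkin's uniqueness theorem on [nonvanishing_C1]: the mass of such a set is the limit of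
    integrals of C^1 functions, hence the same for both measures. *)
Lemma C1_sphere_determining mu nu :
  (forall phi, C1_sphere phi -> \int[mu]_x phi x = \int[nu]_x phi x) ->
  forall A : set (borelType S), measurable A -> mu A = nu A.
Proof.
move=> munu A mA; apply: (@measure_unique _ R (borelType S) nonvanishing_C1 (fun=> setT)
  measurable_nonvanishing_C1 nonvanishing_C1_setI _ _ mu nu _ _ A mA).
- move=> _; exists (fun=> 1); first exact: C1_sphere_cst.
  by apply/seteqP; split=> x //= _; exact: oner_neq0.
- by rewrite bigcup_const.
- move=> {mA}A [h hC ->].
  have mA : measurable ([set x | h x != 0] : set (borelType S)).
    by apply: open_borel; apply: nonvanishing_C1_open; rewrite /nonvanishing_C1/=; exists h.
  rewrite -[LHS]fineK ?fin_num_measure// -[RHS]fineK ?fin_num_measure//; congr EFin.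
  have cmu := @nonvanishing_approx_Rintegral_cvg mu h hC.
  have cnu := @nonvanishing_approx_Rintegral_cvg nu h hC.
  rewrite (_ : (fun n => _) = fun n => \int[nu]_x nonvanishing_approx h n x) in cmu.
    exact: cvg_unique cmu cnu.
  by apply/funext => n; apply: munu; exact: C1_nonvanishing_approx.
- by move=> _; exact: le_lt_trans (probability_le1 mu measurableT) (ltry 1).
Qed.

End C1Determining.

(** * Transport by the flow *)

Section OperatorNorm.
Context {R : realType} {n : nat}.
Implicit Types A : 'M[R]_n.

(** [opnorm] is a bare [sup], informative only for a nonempty set bounded above. The bound used is
    the Euclidean norm of the vector of absolute row sums. *)
Lemma has_sup_opnorm A :
  has_sup [set enorm (A *m x) | x in [set x : 'cV[R]_n | enorm x <= 1]].
Proof.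
split.
  exists (enorm (A *m 0)), 0 => //=.
  by have /eqP -> : enorm (0 : 'cV[R]_n) == 0 by rewrite enorm_eq0.
exists (Num.sqrt (\sum_i (\sum_j `|A i j|) ^+ 2)) => _ [x /= x1 <-].
rewrite /enorm ler_wsqrtr//; apply: ler_sum => i _.
rewrite -(real_normK (num_real _)) ler_pXn2r ?nnegrE ?sumr_ge0//.
rewrite mxE; apply: (le_trans (ler_norm_sum _ _ _)); apply: ler_sum => j _.
rewrite normrM ler_piMr//; apply: le_trans x1; exact: coord_le_enorm.
Qed.

Lemma coord_le_opnorm A i j : `|A i j| <= opnorm A.
Proof.
have -> : A i j = (A *m delta_mx j 0 : 'cV_n) i 0 by rewrite -colE mxE.
apply: (le_trans (coord_le_enorm _ _)).
apply: ub_le_sup; first by have [] := has_sup_opnorm A.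
exists (delta_mx j 0) => //=.
rewrite /enorm (bigD1 j)//= big1 ?addr0; last first.
  by move=> k /negbTE kj; rewrite mxE kj expr0n.
by rewrite mxE !eqxx expr1n sqrtr1.
Qed.

End OperatorNorm.

Section DerivativeAlongCurves.
Context {R : realType}.

Lemma is_derive_comp_diff (V : normedModType R) (c : R -> V) (w : V -> R) (r : R) (c' : V) :
  is_derive r (1 : R) c c' -> differentiable w (c r) ->
  is_derive r (1 : R) (fun s => w (c s)) ('d w (c r) c').
Proof.
move=> [/derivable1_diffP dc cE] dw.
have dwc : differentiable (w \o c) r by exact: differentiable_comp.
apply: DeriveDef; first exact/derivable1_diffP.
by rewrite (deriveE _ dwc) (diff_comp dc dw)/= -cE (deriveE _ dc).
Qed.

(** Treating both signs of [h] at once lets two-sided difference quotients be replaced by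
    derivatives at times close to [s]. *)
Lemma MVT_quotient (f f' : R -> R) (s e h : R) : h != 0 -> `|h| < e ->
  (forall r, `|s - r| < e -> is_derive r (1 : R) f (f' r)) ->
  exists2 r, `|s - r| < e & h^-1 * (f (s + h) - f s) = f' r.
Proof.
move=> h0 he df.
have fc r : `|s - r| < e -> {for r, continuous f}.
  by move=> /df[d _]; apply: differentiable_continuous; exact/derivable1_diffP.
move: he; rewrite ltr_norml => /andP[h1 h2].
have [hlt|hgt|h00] := ltgtP h 0; last by rewrite h00 eqxx in h0.
- have near_s r : s + h <= r -> r <= s -> `|s - r| < e.
    by move=> r1 r2; rewrite ltr_norml; lra.
  have [|||r /[!in_itv]/= /andP[r1 r2] E] := @MVT R f f' (s + h) s _.
  + by rewrite gtrDl.
  + by move=> r /[!in_itv]/= /andP[r1 r2]; apply/df/near_s; exact: ltW.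
  + apply: continuous_in_subspaceT => r /[!inE]/= /[!in_itv]/= /andP[r1 r2].
    exact/fc/near_s.
  exists r; first by apply: near_s; exact: ltW.
  by rewrite -opprB E; field.
- have near_s r : s <= r -> r <= s + h -> `|s - r| < e.
    by move=> r1 r2; rewrite ltr_norml; lra.
  have [|||r /[!in_itv]/= /andP[r1 r2] E] := @MVT R f f' s (s + h) _.
  + by rewrite ltrDl.
  + by move=> r /[!in_itv]/= /andP[r1 r2]; apply/df/near_s; exact: ltW.
  + apply: continuous_in_subspaceT => r /[!inE]/= /[!in_itv]/= /andP[r1 r2].
    exact/fc/near_s.
  exists r; first by apply: near_s; exact: ltW.
  by rewrite E; field.
Qed.

Lemma is_derive_mulmx_col n (H : R -> 'M[R]_n) (H' : 'M[R]_n) (r : R) (y : 'cV[R]_n) :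
  (forall i j, is_derive r (1 : R) (fun s => H s i j) (H' i j)) ->
  is_derive r (1 : R) (fun s => H s *m y) (H' *m y).
Proof.
move=> dH.
have dc i : is_derive r (1 : R) (fun s => (H s *m y) i 0) ((H' *m y) i 0).
  rewrite (_ : (fun s => _) = \sum_k (fun s => H s i k * y k 0)); last first.
    by apply/funext => s; rewrite fct_sumE mxE.
  rewrite mxE; apply: is_derive_sum => k.
  apply: (is_derive_eq (@is_deriveM _ _ (fun s => H s i k) (cst (y k 0)) r 1 _ _
    (dH i k) (is_derive_cst _ _ _))).
  by rewrite scaler0 add0r mulrC.
have dHy : derivable (fun s => H s *m y) r 1.
  by apply/derivable_mxP => i j; rewrite (ord1 j); have [] := dc i.
apply: DeriveDef => //; rewrite derive_mx//; apply/matrixP => i j.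
by rewrite mxE (ord1 j); have [_ ->] := dc i.
Qed.

End DerivativeAlongCurves.

(** * Compatibility of the projective action with the projection *)

Section Pushforward.
Context {R : realType} {d : nat}.
Local Notation S := (sphere R d).
Local Notation V := ('cV[R]_d.+1).

Lemma Rintegral_projection (q : prob_space R d) (phi : S -> R) : continuous phi ->
  \int[(distribution q (@Pi R d) : prob_sphere R d)]_x phi x = \int[q]_y radial_ext phi y.
Proof.
move=> cphi; have mphi := continuous_sphere_measurable cphi.
have [M _ phiM] := continuous_sphere_bounded cphi.
rewrite /Rintegral; congr fine.
rewrite [LHS]integral_pushforward//; first exact/measurable_EFinP.
rewrite preimage_setT.
apply: (@bounded_integrable _ _ _ q (phi \o @Pi R d) M) => [|y]; last exact: phiM.
exact: (measurableT_comp mphi).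
Qed.

(** Acting after projecting agrees with projecting after [Lambda G] at every nonzero vector. At the
    origin [Pi] takes an arbitrary value, and this point is [q]-null. *)
Lemma Rintegral_projection_act (q : prob_space R d) (G : 'M[R]_d.+1) (phi : S -> R) :
  G \in unitmx -> continuous phi -> continuous (phi \o sphere_act G) ->
  q [set (0 : V)] = 0%E ->
  \int[(distribution q (@Pi R d) : prob_sphere R d)]_x phi (sphere_act G x) =
  \int[(distribution (distribution q (Lambda G) : prob_space R d) (@Pi R d) : prob_sphere R d)]_x phi x.
Proof.
move=> Gu cphi cphiG q0.
have mphi := continuous_sphere_measurable cphi.
have mphiG := continuous_sphere_measurable cphiG.
have [M _ phiM] := continuous_sphere_bounded cphi.
have mr : measurable_fun setT (radial_ext phi : Rn R d -> R).
  exact: (measurableT_comp mphi).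
have mrG : measurable_fun setT (radial_ext phi \o Lambda G : Rn R d -> R).
  exact: (measurableT_comp mr).
rewrite (Rintegral_projection q cphiG) Rintegral_projection//.
transitivity (\int[q]_y (radial_ext phi \o Lambda G) y); last first.
  rewrite /Rintegral; congr fine; apply/esym.
  rewrite [LHS]integral_pushforward//; first exact/measurable_EFinP.
  rewrite preimage_setT.
  by apply: (@bounded_integrable _ _ _ q (radial_ext phi \o Lambda G) M) => // y; exact: phiM.
rewrite /Rintegral; apply: (f_equal fine).
apply: (@ae_eq_integral _ _ _ q setT _ _ measurableT).
- by apply/measurable_EFinP; exact: (measurableT_comp mphiG).
- exact/measurable_EFinP.
exists [set (0 : V)]; split => //.
  rewrite -[X in measurable X]setCK; apply: measurableC; apply: open_borel.
  exact/closed_openC/accessible_closed_set1/hausdorff_accessible/norm_hausdorff.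
move=> y /=; apply: contra_notP => /eqP y0 _; congr EFin.
by rewrite [LHS]radial_ext_act.
Qed.

Lemma sphere_actM (K L : 'M[R]_d.+1) (x : S) : K \in unitmx -> L \in unitmx ->
  sphere_act K (sphere_act L x) = sphere_act (K *m L) x.
Proof.
move=> Ku Lu; rewrite {1 3}/sphere_act.
have Lx0 : L *m val x != 0.
  by apply: contra_neq (val_sphere_neq0 x) => Lx0; rewrite -(mulKmx Lu (val x)) Lx0 mulmx0.
have [a a0 ->] := Pi_neq0 Lx0.
rewrite -scalemxAr Pi_scale ?mulmxA//.
apply: contra_neq (val_sphere_neq0 x) => KLx0.
rewrite -mulmxA in KLx0.
by rewrite -(mulKmx Lu (val x)) -(mulKmx Ku (L *m val x)) KLx0 !mulmx0.
Qed.

Lemma sphere_act1 (x : S) : sphere_act 1%:M x = x.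
Proof. by rewrite /sphere_act mul1mx Pi_val. Qed.

End Pushforward.

(** * Conservation of the transported integral *)

Section TransportedIntegral.
Context {R : realType} {d : nat}.
Local Notation S := (sphere R d).
Local Notation V := ('cV[R]_d.+1).
Implicit Types (phi : S -> R) (x : S) (K : R -> 'M[R]_d.+1).

Lemma cvg_mulmx_joint (I : topologicalType) K (f : R * I -> V) (s : R) (x : I) :
  (forall i j, continuous (fun r => K r i j)) ->
  f p @[p --> (s, x)] --> f (s, x) ->
  K p.1 *m f p @[p --> (s, x)] --> K s *m f (s, x).
Proof.
move=> cK cf; apply: (@mx_cvg_coord _ _ (nbhs (s, x))) => i j; rewrite mxE.
under eq_cvg do rewrite mxE.
apply: (@cvg_sum_ord _ _ (nbhs (s, x))) => k; apply: cvgM.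
  apply: (@cvg_comp _ _ _ fst (fun r => K r i k) (nbhs (s, x)) (nbhs s)); first exact: cvg_fst.
  exact: cK.
apply: (@cvg_comp _ _ _ f (fun y : V => y k j) (nbhs (s, x)) (nbhs (f (s, x)))); first exact: cf.
exact: coord_continuous.
Qed.

Lemma cvg_val_snd (s : R) x : (val p.2 : V) @[p --> (s, x)] --> (val x : V).
Proof.
apply: (@cvg_comp _ _ _ snd (val : S -> V) (nbhs (s, x)) (nbhs x)); first exact: cvg_snd.
exact: val_sphere_continuous.
Qed.

Lemma mulmx_val_neq0 (M : 'M[R]_d.+1) x : M \in unitmx -> M *m val x != 0.
Proof.
move=> Mu; apply: contra_neq (val_sphere_neq0 x) => Mx0.
by rewrite -(mulKmx Mu (val x)) Mx0 mulmx0.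
Qed.

Lemma cvg_act_joint phi K (s : R) x : C1_sphere phi -> K s \in unitmx ->
  (forall i j, continuous (fun r => K r i j)) ->
  phi (sphere_act (K p.1) p.2) @[p --> (s, x)] --> phi (sphere_act (K s) x).
Proof.
move=> /C1_sphereP phiC Ku cK.
have cw : {for K s *m val x, continuous (radial_ext phi)}.
  exact: differentiable_continuous (phiC _ (mulmx_val_neq0 x Ku)).1.
exact: (cvg_comp _ _ (cvg_mulmx_joint cK (@cvg_val_snd s x)) cw).
Qed.

Definition act_rate phi (K A : 'M[R]_d.+1) x : R :=
  'd (radial_ext phi) (K *m val x) (K *m (A *m val x)).

Lemma cvg_act_rate_joint phi K (A : R -> 'M[R]_d.+1) (s : R) x : C1_sphere phi -> K s \in unitmx ->
  (forall i j, continuous (fun r => K r i j)) ->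
  (forall i j, continuous (fun r => A r i j)) ->
  act_rate phi (K p.1) (A p.1) p.2 @[p --> (s, x)] --> act_rate phi (K s) (A s) x.
Proof.
move=> /C1_sphereP phiC Ku cK cA.
have cKx := cvg_mulmx_joint cK (@cvg_val_snd s x).
have cKAx := cvg_mulmx_joint cK (cvg_mulmx_joint cA (@cvg_val_snd s x)).
(* Base point and direction both vary, while C^1 regularity gives continuity for a fixed direction;
   expanding the direction in the standard basis separates the two. *)
have rateE (K' A' : 'M[R]_d.+1) (y : S) : act_rate phi K' A' y =
    \sum_i (K' *m (A' *m val y)) i 0 * 'd (radial_ext phi) (K' *m val y) (delta_mx i 0).
  exact: diff_sum_delta.
rewrite rateE; under eq_cvg do rewrite rateE.
apply: (@cvg_sum_ord _ _ (nbhs (s, x))) => i; apply: cvgM.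
  apply: (@cvg_comp _ _ _ _ (fun y : V => y i 0) (nbhs (s, x)) _ _ cKAx).
  exact: coord_continuous.
exact: (cvg_comp _ _ cKx ((phiC _ (mulmx_val_neq0 x Ku)).2 (delta_mx i 0))).
Qed.

Lemma continuous_act_rate phi (K A : 'M[R]_d.+1) : C1_sphere phi -> K \in unitmx ->
  continuous (act_rate phi K A).
Proof.
move=> phiC Ku x.
have c (M : 'M[R]_d.+1) i j : continuous (fun _ : R => M i j) by exact: cst_continuous.
have h := @cvg_act_rate_joint phi (fun=> K) (fun=> A) 0 x phiC Ku (c K) (c A).
have c0 : ((0 : R), y) @[y --> x] --> ((0 : R), x).
  move=> P [[U W] /= [U0 Wx] UW]; apply: filterS Wx => y Wy.
  by apply: UW; split => //=; exact: nbhs_singleton.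
exact: (cvg_comp _ _ c0 h).
Qed.

Context (F : prob_sphere R d -> 'M[R]_d.+1) (mu : R -> prob_sphere R d).
Context (H : R -> 'M[R]_d.+1) (a T : R).
Hypothesis T0 : 0 <= T.
Hypothesis a0 : a < 0.
Hypothesis cA : forall i j, continuous (fun s => F (mu s) i j).
Hypothesis cH : forall i j, continuous (fun s => H s i j).
Hypothesis dH : forall s i j, a < s ->
  is_derive s (1 : R) (fun s => H s i j) ((- (H s *m F (mu s))) i j).
Hypothesis Hu : forall s, H s \in unitmx.
Hypothesis mu_cvg : forall s, W1 (mu r) (mu s) @[r --> s] --> 0%E.
Hypothesis mu_weak : forall phi, C1_sphere phi -> forall t, 0 <= t <= T ->
  \int[mu t]_x phi x - \int[mu 0]_x phi x =
  \int[lebesgue_measure]_(s in `[0, t])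
    \int[mu s]_x ((sphere_grad phi x)^T *m velocity F (val x) (mu s)) 0 0.

Lemma continuous_Rintegral_act phi : C1_sphere phi ->
  continuous (fun s => \int[mu s]_x phi (sphere_act (H s) x)).
Proof.
move=> phiC s.
apply: (@cvg_Rintegral_W1 R d R (nbhs s) (fun r x => phi (sphere_act (H r) x))) => //.
- by move=> r; exact/C1_sphere_continuous/(C1_sphere_act (Hu r)).
- exact/C1_sphere_continuous/(C1_sphere_act (Hu s)).
- by move=> x; exact: (@cvg_act_joint phi H s x phiC (Hu s) cH).
Qed.

(* The integrand is frozen at time s and only the measure moves. *)
Lemma is_derive_Rintegral_frozen phi (s : R) : C1_sphere phi -> 0 < s < T ->
  is_derive s (1 : R) (fun r => \int[mu r]_x phi (sphere_act (H s) x))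
    (\int[mu s]_x act_rate phi (H s) (F (mu s)) x).
Proof.
move=> phiC /andP[s0 sT].
have phisC := C1_sphere_act (Hu s) phiC.
have cB : continuous (fun r => \int[mu r]_x act_rate phi (H s) (F (mu r)) x).
  move=> r.
  apply: (@cvg_Rintegral_W1 R d R (nbhs r) (fun r x => act_rate phi (H s) (F (mu r)) x)) => //.
  - by move=> r'; exact: continuous_act_rate.
  - exact: continuous_act_rate.
  - move=> x; apply: (@cvg_act_rate_joint phi (fun=> H s) (fun r => F (mu r))) => // i j.
    exact: cst_continuous.
apply: (@near_eq_is_derive _ _ _ (cst (\int[mu 0]_x phi (sphere_act (H s) x)) +
  (fun t => \int[lebesgue_measure]_(r in `[0, t]) \int[mu r]_x act_rate phi (H s) (F (mu r)) x))).
  (* As [s] is interior, nearby times stay in [[0, T]], where the weak formulation is available. *)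
  near=> t; rewrite !fctE.
  have tT : 0 <= t <= T.
    by apply/andP; split; apply/ltW; near: t; [exact: lt_nbhsr|exact: lt_nbhsl].
  apply/esym/eqP; rewrite addrC -subr_eq; apply/eqP; rewrite (mu_weak phisC tT).
  apply: eq_Rintegral => r _; apply: eq_Rintegral => x _.
  exact: sphere_grad_velocity.
by rewrite -[X in is_derive _ _ _ X]add0r; apply: is_deriveD; exact: is_derive_Rintegral.
Unshelve. all: by end_near. Qed.

Lemma is_derive_act phi x (s : R) : C1_sphere phi -> a < s ->
  is_derive s (1 : R) (fun r => phi (sphere_act (H r) x)) (- act_rate phi (H s) (F (mu s)) x).
Proof.
move=> /C1_sphereP phiC as_.
have dc := is_derive_mulmx_col (val x) (fun i j => dH i j as_).
have := is_derive_comp_diff dc (phiC _ (mulmx_val_neq0 x (Hu s))).1.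
by rewrite mulNmx -mulmxA linearN.
Qed.

(* The complementary part of the difference quotient: only the integrand moves,
   and the mean value theorem makes the convergence uniform on the sphere. *)
Lemma cvg_Rintegral_act_quotient phi (s : R) : C1_sphere phi -> a < s ->
  \int[mu (s + h)]_x (h^-1 * (phi (sphere_act (H (s + h)) x) - phi (sphere_act (H s) x)))
    @[h --> 0^'] --> \int[mu s]_x (- act_rate phi (H s) (F (mu s)) x).
Proof.
move=> phiC as_.
have cact r : continuous (fun x => phi (sphere_act (H r) x)).
  exact/C1_sphere_continuous/(C1_sphere_act (Hu r)).
have crate := @continuous_act_rate phi _ (F (mu s)) phiC (Hu s).
have cneg : continuous (fun x : S => - act_rate phi (H s) (F (mu s)) x).
  by move=> x; exact: (cvgN (crate x)).
have cquot h : continuous (fun x : S =>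
    h^-1 * (phi (sphere_act (H (s + h)) x) - phi (sphere_act (H s) x))).
  move=> x; apply: (@cvgMl_tmp _ _ (nbhs x)); exact: (cvgB (cact _ x) (cact _ x)).
have shift0 : s + h @[h --> (0 : R)^'] --> s.
  have : s + h @[h --> (0 : R)] --> s + 0 by apply: cvgD; [exact: cvg_cst|exact: cvg_id].
  by rewrite addr0; exact: cvg_within_filter.
apply: (@cvg_Rintegral_W1 R d R (0^')
  (fun h x => h^-1 * (phi (sphere_act (H (s + h)) x) - phi (sphere_act (H s) x)))).
- exact: cquot.
- exact: cneg.
- move=> x; apply/cvgrPdist_le => e e0.
  have /cvgrPdist_le/(_ e e0) := @cvg_act_rate_joint phi H (fun r => F (mu r)) s x phiC (Hu s) cH cA.
  case=> -[U W] /= [Us Wx] UW.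
  (* The radius keeps the intermediate time in [U] and beyond [a], where [H] is differentiable. *)
  have /nbhs_ballP[r /= r0 rU] : nbhs s (U `&` [set r | a < r]).
    by apply: filterI => //; exact: lt_nbhsr.
  exists ([set h | h != 0 /\ `|h| < r], W) => /=.
    split => //; near=> h; split; first by near: h; exact: nbhs_dnbhs_neq.
    by near: h; exact: dnbhs0_lt.
  move=> [h y] /= [[h0 hr] Wy].
  have [|s' s's ->] := @MVT_quotient R (fun r => phi (sphere_act (H r) y))
    (fun r => - act_rate phi (H r) (F (mu r)) y) s r h h0 hr.
    by move=> r' r's; apply: is_derive_act => //; have [] := rU r' r's.
  rewrite -opprD normrN.
  have [Us' _] := rU s' s's.
  exact: (UW (s', y) (conj Us' Wy)).
- exact: (cvg_comp _ _ shift0 (mu_cvg s)).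
Unshelve. all: by end_near. Qed.

(** A product rule: integrating the increment of the integrand against the moved measure
    [mu (s + h)] makes the two partial quotients add up exactly to the full one, and their limits
    are opposite. *)
Lemma is_derive_Rintegral_act phi (s : R) : C1_sphere phi -> 0 < s < T ->
  is_derive s (1 : R) (fun r => \int[mu r]_x phi (sphere_act (H r) x)) 0.
Proof.
move=> phiC sT; have as_ : a < s by case/andP : sT => s0 _; exact: lt_trans a0 s0.
have cact r : continuous (fun x => phi (sphere_act (H r) x)).
  exact/C1_sphere_continuous/(C1_sphere_act (Hu r)).
have crate := @continuous_act_rate phi _ (F (mu s)) phiC (Hu s).
have q1 := cvg_Rintegral_act_quotient phiC as_.
have [dJ JE] := is_derive_Rintegral_frozen phiC sT.
have q2 : h^-1 * (\int[mu (s + h)]_x phi (sphere_act (H s) x) - \int[mu s]_x phi (sphere_act (H s) x))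
    @[h --> 0^'] --> \int[mu s]_x act_rate phi (H s) (F (mu s)) x.
  rewrite -JE; move: dJ; rewrite /derive /derivable.
  rewrite (_ : (fun h => h^-1 *: _) = fun h => h^-1 *
     (\int[mu (s + h)]_x phi (sphere_act (H s) x) - \int[mu s]_x phi (sphere_act (H s) x))) //.
  by apply/funext => h; rewrite /= /GRing.scale/= mulr1 [h + s]addrC.
have <- : \int[mu s]_x (- act_rate phi (H s) (F (mu s)) x) +
    \int[mu s]_x act_rate phi (H s) (F (mu s)) x = 0.
  under eq_Rintegral do rewrite -mulN1r.
  rewrite RintegralZl//; last exact: continuous_sphere_integrable.
  by rewrite mulN1r addNr.
have q : (fun h : R => h^-1 *: (((fun r => \int[mu r]_x phi (sphere_act (H r) x)) \o shift s) (h *: 1) -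
     \int[mu s]_x phi (sphere_act (H s) x))) @ 0^' -->
    \int[mu s]_x (- act_rate phi (H s) (F (mu s)) x) +
    \int[mu s]_x act_rate phi (H s) (F (mu s)) x.
  apply: cvg_trans (cvgD q1 q2); apply: near_eq_cvg; near=> h.
  rewrite !fctE /= /GRing.scale/= mulr1 [h + s]addrC.
  rewrite RintegralZl//; last first.
    by apply: continuous_sphere_integrable => x; exact: (cvgB (cact _ x) (cact _ x)).
  rewrite RintegralB//; [|exact: continuous_sphere_integrable..].
  by rewrite -mulrDr subrKA.
by apply: DeriveDef; [apply/cvg_ex; eexists; exact: q|exact: cvg_lim q].
Unshelve. all: by end_near. Qed.

Lemma Rintegral_act_conserved phi : C1_sphere phi ->
  \int[mu T]_x phi (sphere_act (H T) x) = \int[mu 0]_x phi (sphere_act (H 0) x).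
Proof.
move=> phiC; apply/eqP; rewrite -subr_eq0; apply/eqP.
have [||c _ ->] := @MVT_segment R (fun s => \int[mu s]_x phi (sphere_act (H s) x))
  (fun=> 0) 0 T T0.
- by move=> s /[!in_itv]/= sT; exact: is_derive_Rintegral_act.
- by apply: continuous_subspaceT; exact: continuous_Rintegral_act.
- by rewrite mul0r.
Qed.

End TransportedIntegral.

(** * Extension of the curve to the whole line *)

Section ClampedCurve.
Context {R : realType} {d : nat}.
Local Notation S := (sphere R d).

(* Composition with clamp extends a curve from [0, T] to the whole line. *)
Definition clamp (T s : R) : R := Num.min (Num.max s 0) T.

Lemma clamp_id (T s : R) : 0 <= s <= T -> clamp T s = s.
Proof. by move=> /andP[s0 sT]; rewrite /clamp (max_l s0) (min_l sT). Qed.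

Lemma clamp_itv (T s : R) : 0 <= T -> 0 <= clamp T s <= T.
Proof. by move=> T0; rewrite /clamp le_min le_max lexx orbT T0 ge_min lexx orbT. Qed.

Lemma continuous_clamp (T : R) : continuous (clamp T).
Proof.
have cmax : continuous (fun s : R => Num.max s 0).
  move=> s; apply: (@continuous_max _ _ idfun (cst 0)); [exact: cvg_id|exact: cvg_cst].
move=> s; exact: (@continuous_min _ _ (fun s : R => Num.max s 0) (cst T) s (cmax s)
  (@cst_continuous R R T s)).
Qed.

(** Clamped times are nonnegative, so continuity within the half-line, one-sided at 0, becomes
    continuity on both sides. *)
Lemma cvg_clamp_W1 (rho : R -> prob_sphere R d) (T s : R) : 0 <= T ->
  (forall t : R, 0 <= t ->
    W1 (rho s) (rho t) @[s --> within [set s | 0 <= s] (nbhs t)] --> 0%E) ->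
  W1 (rho (clamp T r)) (rho (clamp T s)) @[r --> s] --> 0%E.
Proof.
move=> T0 rho_cvg; have /andP[cs0 _] := clamp_itv s T0.
apply: (@cvg_comp _ _ _ (clamp T) (fun r => W1 (rho r) (rho (clamp T s))) (nbhs s)
  (within [set s | 0 <= s] (nbhs (clamp T s))) (nbhs 0%E)); last exact: rho_cvg.
move=> P /= PW.
have nearP : \forall r \near s, 0 <= clamp T r -> P (clamp T r).
  exact: (@continuous_clamp T s _ PW).
apply: filterS nearP => r; apply.
by have /andP[] := clamp_itv r T0.
Qed.

Lemma continuous_coord_W1 (F : prob_sphere R d -> 'M[R]_d.+1) (L : R)
    (mu : R -> prob_sphere R d) i j : 0 <= L ->
  (forall mu nu : prob_sphere R d, ((opnorm (F mu - F nu))%:E <= L%:E * W1 mu nu)%E) ->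
  (forall s, W1 (mu r) (mu s) @[r --> s] --> 0%E) ->
  continuous (fun s => F (mu s) i j).
Proof.
move=> L0 FL mu_cvg s; apply/cvgrPdist_le => e e0.
have eL : 0 < e / (L + 1) by rewrite divr_gt0// ltr_wpDl.
have : \forall r \near s, (W1 (mu r) (mu s) < (e / (L + 1))%:E)%E.
  apply: (mu_cvg s [set y | (y < (e / (L + 1))%:E)%E]).
  by apply: open_nbhs_nbhs; split; [exact: open_ereal_lt_ereal|rewrite /= lte_fin].
apply: filterS => r Wr.
have -> : F (mu s) i j - F (mu r) i j = - ((F (mu r) - F (mu s)) i j).
  by rewrite [in RHS]mxE [X in - (_ + X)]mxE opprB.
rewrite normrN; apply: (le_trans (coord_le_opnorm _ _ _)).
rewrite -lee_fin; apply: (le_trans (FL _ _)).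
apply: (@le_trans _ _ (L%:E * (e / (L + 1))%:E)%E).
  by apply: lee_wpmul2l; [rewrite lee_fin|exact: ltW].
rewrite -EFinM lee_fin mulrCA ler_piMr ?(ltW e0)//.
by rewrite ler_pdivrMr ?ltr_wpDl// mul1r lerDl.
Qed.

(** The sum of all absolute entries attains its maximum on [[0, T]], and clamping spreads this bound
    to every time. *)
Lemma clamped_bounded n (A : R -> 'M[R]_n) (T : R) : 0 <= T ->
  (forall i j, continuous (fun s => A s i j)) ->
  (forall s, A s = A (clamp T s)) ->
  exists M : R, forall s i j, `|A s i j| <= M.
Proof.
move=> T0 cA AT.
have cS : continuous (fun s => \sum_i \sum_j `|A s i j|).
  move=> s; apply: (@cvg_sum_ord _ _ (nbhs s)) => i.
  by apply: (@cvg_sum_ord _ _ (nbhs s)) => j; apply: cvg_norm; exact: cA.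
have [c _ cmax] := EVT_max T0 (continuous_subspaceT cS).
exists (\sum_i \sum_j `|A c i j|) => s i j; rewrite AT.
apply: le_trans (cmax _ _); last by rewrite in_itv/=; exact: clamp_itv.
rewrite (bigD1 i)//= (bigD1 j)//= -addrA lerDl addr_ge0// ?sumr_ge0// => k _.
by rewrite sumr_ge0.
Qed.

Lemma weak_solution_pushforward (F : prob_sphere R d -> 'M[R]_d.+1) (L : R)
    (rho0 : prob_sphere R d) (rho : R -> prob_sphere R d) (T : R) :
  0 <= L ->
  (forall mu nu : prob_sphere R d, ((opnorm (F mu - F nu))%:E <= L%:E * W1 mu nu)%E) ->
  weak_solution F rho0 rho -> 0 <= T ->
  exists2 G : 'M[R]_d.+1, G \in unitmx & forall phi, C1_sphere phi ->
    \int[rho T]_x phi x = \int[rho0]_x phi (sphere_act G x).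
Proof.
move=> L0 FL [rho_cvg rho_0 rho_weak] T0.
(* Clamping discards the unconstrained values of [rho] at negative times and gives a coefficient
   matrix bounded on the whole line, as [adjoint_fundamental_matrix] requires. *)
pose mu s := rho (clamp T s).
have muE s : 0 <= s <= T -> mu s = rho s by move=> sT; rewrite /mu clamp_id.
have mu_cvg s : W1 (mu r) (mu s) @[r --> s] --> 0%E by exact: cvg_clamp_W1.
have cA i j : continuous (fun s => F (mu s) i j)
    by exact: (@continuous_coord_W1 F L mu i j L0 FL mu_cvg).
have [|M AM] := @clamped_bounded _ (fun s => F (mu s)) T T0 cA.
  by move=> s; rewrite /mu [clamp T (clamp T s)]clamp_id ?clamp_itv.
(* Starting the equation at -1 makes 0 an interior point. *)
have [H [cH dH Hu]] := adjoint_fundamental_matrix (-1) cA AM.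
have int0 phi : \int[mu 0]_x phi x = \int[rho0]_x phi x.
  rewrite muE ?lexx//; rewrite /Rintegral; apply: (f_equal fine).
  by apply: eq_measure_integral => A mA _; exact: rho_0.
have mu_weak phi : C1_sphere phi -> forall t, 0 <= t <= T ->
    \int[mu t]_x phi x - \int[mu 0]_x phi x =
    \int[lebesgue_measure]_(s in `[0, t])
      \int[mu s]_x ((sphere_grad phi x)^T *m velocity F (val x) (mu s)) 0 0.
  move=> phiC t tT; rewrite int0 (muE _ tT).
  rewrite rho_weak; [|exact: phiC|by case/andP : tT].
  apply: eq_Rintegral => s /[!inE]/= /[!in_itv]/= /andP[s0 st].
  by rewrite muE// s0 (le_trans st)//; case/andP : tT.
pose G := invmx (H T) *m H 0.
exists G => [|phi phiC]; first by rewrite unitmx_mul unitmx_inv !Hu.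
have Tu : invmx (H T) \in unitmx by rewrite unitmx_inv.
(* Conservation is applied to [phi] composed with the action of [invmx (H T)], so that [H T] cancels
   at time [T] and [G] appears at time 0. *)
have := Rintegral_act_conserved T0 (@ltrN10 R) cA cH dH Hu mu_cvg mu_weak
  (C1_sphere_act Tu phiC).
have TT : 0 <= T <= T by rewrite T0 lexx.
rewrite int0 (muE _ TT).
under eq_Rintegral do rewrite /= sphere_actM// mulVmx// sphere_act1.
by under [X in _ = X -> _]eq_Rintegral do rewrite /= sphere_actM//.
Qed.

End ClampedCurve.

Theorem proposition3p7 (R : realType) (d : nat)
  (F : prob_sphere R d -> 'M[R]_d.+1)
  (F_lipschitz : exists2 L : R, 0 <= L &
    forall mu nu : prob_sphere R d,
      ((opnorm (F mu - F nu))%:E <= L%:E * W1 mu nu)%E)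
  (F_traceless : forall mu : prob_sphere R d, \tr (F mu) = 0)
  (Q : set (prob_space R d))
  (Q_parametric : parametric_family Q)
  (Q_origin : forall q, Q q -> q [set (0 : 'cV[R]_d.+1)] = 0%E)
  (Q_closed : forall (q : prob_space R d) (G : 'M[R]_d.+1),
    Q q -> G \in unitmx -> Q (distribution q (Lambda G))) :
  forall (rho0 : prob_sphere R d) (rho : R -> prob_sphere R d),
    projected_family Q rho0 -> weak_solution F rho0 rho ->
    forall t : R, 0 <= t -> projected_family Q (rho t).
Proof.
have [L L0 FL] := F_lipschitz.
move=> rho0 rho [q Qq rho0E] rho_sol t t0.
have [G Gu rhoG] := weak_solution_pushforward L0 FL rho_sol t0.
exists (distribution q (Lambda G)); first exact: Q_closed.
apply: C1_sphere_determining => phi phiC; rewrite rhoG//.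
rewrite -Rintegral_projection_act//; last first.
- exact: Q_origin.
- exact/C1_sphere_continuous/(C1_sphere_act Gu).
- exact: C1_sphere_continuous.
(* [rho0] agrees with the projection of [q] on measurable sets, which is enough for their integrals
   to coincide. *)
rewrite /Rintegral; apply: (f_equal fine).
by apply: eq_measure_integral => A mA _; exact: rho0E.
Qed.
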